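(* Let $-1<a<1$ and $0<z<\frac{\pi}{6}$. Then the following four identities hold: $$a^2\sum_{n=1}^\infty \frac{(2\sin z)^{2n}}{n\binom{2n}{n}((2n)^2-a^2)}\prod_{k=1}^{n-1}\left(1-\frac{a^2}{(2k)^2}\right)= -\cos(az)\operatorname{Re}\sum_{n=1}^\infty\frac{n(1-e^{-2iz})^n}{n^2-a^2}+a\sin(az)\operatorname{Im}\sum_{n=1}^\infty\frac{(1-e^{-2iz})^n}{n^2-a^2},$$ $$2a\sum_{n=1}^\infty \frac{(2\sin z)^{2n}}{\binom{2n}{n}((2n)^2-a^2)}\prod_{k=1}^{n-1}\left(1-\frac{a^2}{(2k)^2}\right)= -a\cos(az)\operatorname{Re}\sum_{n=1}^\infty\frac{(1-e^{-2iz})^n}{n^2-a^2}+\sin(az)\operatorname{Im}\sum_{n=1}^\infty\frac{n(1-e^{-2iz})^n}{n^2-a^2},$$ $$2\sum_{n=0}^\infty\binom{2n}{n}\frac{(\sin z)^{2n+1}(2n+1)}{2^{2n}((2n+1)^2-a^2)}\prod_{k=0}^{n-1}\left(1-\frac{a^2}{(2k+1)^2}\right)=\cos(az)\operatorname{Im}\sum_{n=1}^\infty\frac{n(1-e^{-2iz})^n}{n^2-a^2}+a\sin(az)\operatorname{Re}\sum_{n=1}^\infty\frac{(1-e^{-2iz})^n}{n^2-a^2},$$ $$2a\sum_{n=0}^\infty\binom{2n}{n}\frac{(\sin z)^{2n+1}}{2^{2n}((2n+1)^2-a^2)}\prod_{k=0}^{n-1}\left(1-\frac{a^2}{(2k+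1)^2}\right)=a\cos(az)\operatorname{Im}\sum_{n=1}^\infty\frac{(1-e^{-2iz})^n}{n^2-a^2}+\sin(az)\operatorname{Re}\sum_{n=1}^\infty\frac{n(1-e^{-2iz})^n}{n^2-a^2}.$$
   Context: $i$ is the imaginary unit and empty products equal $1$. *)

(* Defs.v *)
From Stdlib Require Import Reals List.
From Coquelicot Require Import Coquelicot.
Open Scope R_scope.

Definition Cexp (w : C) : C :=
  (RtoC (exp (Re w)) * (cos (Im w), sin (Im w)))%C.

(* Product of [f k] over [m <= k < n], equal to 1 when [n <= m]. *)
Definition Rprod (m n : nat) (f : nat -> R) : R :=
  fold_right Rmult 1 (map f (seq m (n - m))).

Definition binom (n k : nat) : R := Binomial.C n k.

(* Summands with their own index [n]: the [even_*], [cterm] and [ncterm] series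
   run over [n >= 1], the [odd_*] series over [n >= 0]. *)
Definition even_term1 (a z : R) (n : nat) : R :=
  (2 * sin z) ^ (2 * n)
    / (INR n * binom (2 * n) n * (INR (2 * n) ^ 2 - a ^ 2))
  * Rprod 1 n (fun k => 1 - a ^ 2 / INR (2 * k) ^ 2).

Definition even_term2 (a z : R) (n : nat) : R :=
  (2 * sin z) ^ (2 * n)
    / (binom (2 * n) n * (INR (2 * n) ^ 2 - a ^ 2))
  * Rprod 1 n (fun k => 1 - a ^ 2 / INR (2 * k) ^ 2).

Definition odd_term1 (a z : R) (n : nat) : R :=
  binom (2 * n) n
  * (sin z ^ (2 * n + 1) * INR (2 * n + 1)
       / (2 ^ (2 * n) * (INR (2 * n + 1) ^ 2 - a ^ 2)))
  * Rprod 0 n (fun k => 1 - a ^ 2 / INR (2 * k + 1) ^ 2).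

Definition odd_term2 (a z : R) (n : nat) : R :=
  binom (2 * n) n
  * (sin z ^ (2 * n + 1)
       / (2 ^ (2 * n) * (INR (2 * n + 1) ^ 2 - a ^ 2)))
  * Rprod 0 n (fun k => 1 - a ^ 2 / INR (2 * k + 1) ^ 2).

Definition base (z : R) : C :=
  (RtoC 1 - Cexp (- (RtoC 2 * Ci * RtoC z)))%C.

Definition cterm (a z : R) (n : nat) : C :=
  (base z ^ n / RtoC (INR n ^ 2 - a ^ 2))%C.

Definition ncterm (a z : R) (n : nat) : C :=
  (RtoC (INR n) * base z ^ n / RtoC (INR n ^ 2 - a ^ 2))%C.

(* Main.v *)
Require Import Defs.
From Stdlib Require Import Reals List Lra Lia Psatz.
From Coquelicot Require Import Coquelicot.
Open Scope R_scope.

(** Both sides of the identities are functions of [z] that satisfy the same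
    linear differential system, whose singularity at [0] leaves only one solution
    that is [O(sin z)].

    Write [b = 1 - exp (- 2 i z)], so that [b' / b = cot z - i], and let [S0] and
    [S1] be the sums of [b ^ n / (n ^ 2 - a ^ 2)] and [n b ^ n / (n ^ 2 - a ^ 2)].
    Differentiating termwise and summing a geometric series gives
    [S0' = (cot z - i) S1] and [S1' = 2 i + a ^ 2 (cot z - i) S0].  It follows that
    the right-hand sides [R1], [R2], [R3], [R4] of the four identities satisfy
    (lemma [is_derive_rhs])

      [R1' = a (cot z) R2],  [R2' = 2 sin (a z) + a (cot z) R1],
      [R3' = 2 cos (a z) + a (cot z) R4],  [R4' = a (cot z) R3].

    On the left, let [y_n] be the coefficients of a solution of [g'' = - a ^ 2 g]
    expanded in powers of [sin z]; they satisfy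
    [(n + 1) (n + 2) y_(n+2) = (n ^ 2 - a ^ 2) y_n], and the central binomial
    coefficients and products of the statement are closed forms of them
    ([sin_coef_even], [sin_coef_odd]).  The left-hand sides are, up to constants,
    the sums of [n y_n (sin z) ^ n / (n ^ 2 - a ^ 2)] and
    [n ^ 2 y_n (sin z) ^ n / (n ^ 2 - a ^ 2)].  As [d/dz] is [cot z] times the Euler
    operator of [sin z], the derivative of the first sum is [cot z] times the
    second, and that of the second is [g' + a ^ 2 (cot z)] times the first.  For the
    even and the odd solution [g] these are the two systems above.

    The difference of the two sides solves the homogeneous system
    [u' = a (cot z) v], [v' = a (cot z) u], so [u + v] and [u - v] are multiples of
    [(sin z) ^ a] and [(sin z) ^ (- a)].  Both are [O(sin z)] at [0], hence zero
    because [|a| < 1] ([cot_system_zero]). *)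

(** * Termwise differentiation of dominated series *)

(** The Weierstrass M-test: the remainder after [n] terms is bounded by that of
    [M], which is independent of the point. *)
Lemma CVU_dom_series_dominated (f : nat -> R -> R) (M : nat -> R) (D : R -> Prop) :
  (forall n x, D x -> Rabs (f n x) <= M n) -> ex_series M ->
  CVU_dom (fun n x => sum_n (fun k => f k x) n) D.
Proof.
  intros HM [l Hl] eps.
  assert (Htail : eventually (fun n => Rabs (sum_n M n - l) < eps)).
  { assert (Hl' : is_lim_seq (sum_n M) l) by exact Hl.
    apply is_lim_seq_spec in Hl'. exact (Hl' eps). }
  destruct Htail as [N HN]. exists N. intros n Hn x Dx.
  assert (ExM : ex_series M) by (exists l; exact Hl).
  assert (Exf : ex_series (fun k => f k x)).
  { apply (@ex_series_le R_AbsRing R_CompleteNormedModule _ M); [|exact ExM].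
    intro k. apply (HM k x Dx). }
  change (Rabs (sum_n (fun k => f k x) n - Series (fun k => f k x)) < eps).
  assert (Bound : forall k, 0 <= Rabs (f (S n + k)%nat x) <= M (S n + k)%nat).
  { intro k. split; [apply Rabs_pos | apply (HM _ x Dx)]. }
  assert (ExMt : ex_series (fun k => M (S n + k)%nat)).
  { apply (proj1 (ex_series_incr_n M (S n))). exact ExM. }
  rewrite (Series_incr_n (fun k => f k x) (S n)) by (lia || assumption).
  rewrite <- sum_n_Reals. cbn [pred].
  replace (_ - _) with (- Series (fun k => f (S n + k)%nat x)) by ring.
  rewrite Rabs_Ropp.
  apply Rle_lt_trans with (Series (fun k => M (S n + k)%nat)).
  { apply Rle_trans with (Series (fun k => Rabs (f (S n + k)%nat x))).
    - apply Series_Rabs.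
      apply (@ex_series_le R_AbsRing R_CompleteNormedModule _ (fun k => M (S n + k)%nat)).
      + intro k. unfold norm; simpl. unfold abs; simpl.
        rewrite Rabs_Rabsolu. apply (Bound k).
      + exact ExMt.
    - apply Series_le; [exact Bound | exact ExMt]. }
  generalize (Series_incr_n M (S n) ltac:(lia) ExM).
  rewrite <- sum_n_Reals. cbn [pred]. rewrite (is_series_unique M l Hl).
  intro E. specialize (HN n Hn).
  apply Rabs_def2 in HN. lra.
Qed.

(** Termwise differentiation: domination by the same summable [M] makes both
    the partial sums and their derivatives converge uniformly. *)
Lemma is_derive_series_dominated (f g : nat -> R -> R) (M : nat -> R) (lo hi : R) :
  (forall n x, lo < x < hi -> is_derive (f n) x (g n x)) ->
  (forall n x, lo < x < hi -> continuity_pt (g n) x) ->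
  (forall n x, lo < x < hi -> Rabs (f n x) <= M n) ->
  (forall n x, lo < x < hi -> Rabs (g n x) <= M n) ->
  ex_series M ->
  forall x, lo < x < hi ->
  is_derive (fun y => Series (fun n => f n y)) x (Series (fun n => g n x)).
Proof.
  intros Df Cg Bf Bg ExM.
  set (D := fun x => lo < x < hi).
  assert (OD : open D).
  { apply open_and; [apply open_gt | apply open_lt]. }
  assert (Dsum : forall n x, D x ->
     is_derive (fun y => sum_n (fun k => f k y) n) x (sum_n (fun k => g k x) n)).
  { intros n x Dx. apply (is_derive_sum_n (fun k => f k)). intros k _. exact (Df k x Dx). }
  assert (EqD : forall n x, D x ->
     Derive (fun y => sum_n (fun k => f k y) n) x = sum_n (fun k => g k x) n).
  { intros n x Dx. apply is_derive_unique, Dsum, Dx. }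
  intros x Dx.
  assert (Ub : CVU_dom (fun n y => Derive (fun t => sum_n (fun k => f k t) n) y) D).
  { intro eps. destruct (CVU_dom_series_dominated g M D Bg ExM eps) as [N HN].
    exists N. intros n Hn y Dy. specialize (HN n Hn y Dy).
    rewrite EqD by exact Dy.
    erewrite (Lim_seq_ext (fun n0 => Derive _ y)) by (intro; apply EqD; exact Dy).
    exact HN. }
  assert (H := CVU_Derive (fun n y => sum_n (fun k => f k y) n) D OD).
  unfold Series.
  erewrite <- (Lim_seq_ext (fun n0 => Derive _ x)) by (intro; apply EqD; exact Dx).
  apply H; clear H.
  - intros u v w Du Dv [Huw Hwv]. unfold D in *. lra.
  - exact (CVU_dom_series_dominated f M D Bf ExM).
  - intros n y Dy. eexists. apply Dsum, Dy.
  - intros n y Dy.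
    apply (continuity_pt_ext_loc (fun t => sum_n (fun k => g k t) n)).
    + apply (locally_open D); [exact OD | | exact Dy].
      intros t Dt. symmetry. apply EqD, Dt.
    + apply continuity_pt_filterlim.
      induction n as [|n IH].
      * apply (continuous_ext (g 0%nat)); [intro t; now rewrite sum_O|].
        apply continuity_pt_filterlim, Cg, Dy.
      * apply (continuous_ext (fun t => plus (sum_n (fun k => g k t) n) (g (S n) t)));
          [intro t; now rewrite sum_Sn|].
        apply (continuous_plus (V := R_NormedModule)); [exact IH|].
        apply continuity_pt_filterlim, Cg, Dy.
  - exact Ub.
  - exact Dx.
Qed.

Lemma ex_series_geom_dominated (f : nat -> R) (B r : R) :
  0 <= r < 1 -> (forall n, Rabs (f n) <= B * r ^ S n) -> ex_series f.
Proof.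
  intros Hr Hf.
  apply (@ex_series_le R_AbsRing R_CompleteNormedModule _ (fun n => B * r ^ S n)); [exact Hf|].
  apply (ex_series_ext (fun n => (B * r) * r ^ n)); [intro n; simpl; ring|].
  apply (@ex_series_scal R_AbsRing R_NormedModule (B * r)), ex_series_geom.
  rewrite Rabs_right; lra.
Qed.

Lemma Series_geom_dominated (f : nat -> R) (B r : R) :
  0 <= r <= 1 / 2 -> (forall n, Rabs (f n) <= B * r ^ S n) ->
  Rabs (Series f) <= 2 * B * r.
Proof.
  intros Hr Hf.
  assert (Hr1 : Rabs r < 1) by (rewrite Rabs_right; lra).
  assert (HB : 0 <= B * r).
  { generalize (Hf 0%nat) (Rabs_pos (f 0%nat)). simpl. rewrite Rmult_1_r. lra. }
  assert (ExA : ex_series (fun n => Rabs (f n))).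
  { apply (ex_series_geom_dominated _ B r); [lra|]. intro n. rewrite Rabs_Rabsolu. apply Hf. }
  eapply Rle_trans; [apply Series_Rabs, ExA|].
  apply Rle_trans with (Series (fun n => (B * r) * r ^ n)).
  - apply Series_le.
    + intro n. split; [apply Rabs_pos|].
      replace (B * r * r ^ n) with (B * r ^ S n) by (simpl; ring). apply Hf.
    + apply (@ex_series_scal R_AbsRing R_NormedModule), ex_series_geom, Hr1.
  - rewrite Series_scal_l, Series_geom by exact Hr1.
    replace (2 * B * r) with (B * r * 2) by ring.
    apply Rmult_le_compat_l; [exact HB|].
    apply (Rmult_le_reg_r (1 - r)); [lra|]. rewrite Rinv_l; lra.
Qed.

(** * Homogeneous equations with cotangent coefficients *)

Definition O_sin (f : R -> R) : Prop :=
  exists K d, 0 < d /\ forall x, 0 < x < d -> Rabs (f x) <= K * sin x.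

Lemma O_sin_comb (p q f g : R -> R) (P Q : R) :
  (forall x, Rabs (p x) <= P) -> (forall x, Rabs (q x) <= Q) ->
  O_sin f -> O_sin g -> O_sin (fun x => p x * f x + q x * g x).
Proof.
  intros Hp Hq [K1 [d1 [Hd1 B1]]] [K2 [d2 [Hd2 B2]]].
  exists (P * K1 + Q * K2), (Rmin d1 d2). split; [now apply Rmin_glb_lt|].
  intros x Hx. generalize (Rmin_l d1 d2) (Rmin_r d1 d2). intros.
  eapply Rle_trans; [apply Rabs_triang|].
  rewrite !Rabs_mult, Rmult_plus_distr_r, !Rmult_assoc.
  apply Rplus_le_compat; apply Rmult_le_compat; try apply Rabs_pos; auto.
  - apply B1; lra.
  - apply B2; lra.
Qed.

Lemma O_sin_lin (p q : R) (f g : R -> R) :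
  O_sin f -> O_sin g -> O_sin (fun x => p * f x + q * g x).
Proof.
  apply (O_sin_comb (fun _ => p) (fun _ => q) f g (Rabs p) (Rabs q)); intro; apply Rle_refl.
Qed.

(** The solutions of [w' = c (cot x) w] are the multiples of [(sin x) ^ c], so
    [w x * (sin x) ^ (- c)] is constant.  Since [w = O(sin)], it is also
    [O((sin x) ^ (1 - c))], which tends to [0] at [0] because [c < 1]. *)
Lemma cot_ode_zero (c b : R) (w : R -> R) :
  c < 1 -> b <= PI ->
  (forall x, 0 < x < b -> is_derive w x (c * (cos x / sin x) * w x)) ->
  O_sin w ->
  forall x, 0 < x < b -> w x = 0.
Proof.
  intros Hc Hb Dw [K [d [Hd HK]]] x Hx.
  set (h := fun t => w t * exp (- c * ln (sin t))).
  assert (Dh : forall t, 0 < t < b -> is_derive h t 0).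
  { intros t Ht. assert (Hs : 0 < sin t) by (apply sin_gt_0; lra).
    assert (E : is_derive (fun t => exp (- c * ln (sin t))) t
                  (exp (- c * ln (sin t)) * (- c * (cos t / sin t)))).
    { auto_derive; [exact Hs | field; lra]. }
    unfold h. evar_last; [apply (is_derive_mult w _ t _ _ (Dw t Ht) E Rmult_comm)|].
    unfold plus, mult; simpl. ring. }
  assert (Hconst : forall e, 0 < e < x -> h e = h x).
  { intros e He. apply (eq_is_derive h e x); [|lra].
    intros t Ht. apply Dh. lra. }
  assert (Hh : h x = 0).
  { destruct (Req_dec (h x) 0) as [H0|H0]; [exact H0|exfalso].
    assert (Hd0 : 0 < Rabs (h x)) by (apply Rabs_pos_lt, H0).
    set (K' := Rabs K + 1).
    assert (HK' : 0 < K') by (unfold K'; generalize (Rabs_pos K); lra).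
    (* At [e3] the bound [K' * e ^ (1 - c)] on [|h e|] is half of [|h x|]; but
       [h e = h x] for every smaller [e]. *)
    set (e3 := exp (ln (Rabs (h x) / (2 * K')) / (1 - c))).
    assert (He3 : 0 < e3) by apply exp_pos.
    set (e := Rmin e3 (Rmin (d / 2) (x / 2))).
    assert (He : 0 < e /\ e <= e3 /\ e <= d / 2 /\ e <= x / 2).
    { unfold e. repeat split.
      - repeat apply Rmin_glb_lt; lra.
      - apply Rmin_l.
      - eapply Rle_trans; [apply Rmin_r | apply Rmin_l].
      - eapply Rle_trans; [apply Rmin_r | apply Rmin_r]. }
    destruct He as [He0 [He1 [He2 He4]]].
    assert (Hs : 0 < sin e) by (apply sin_gt_0; lra).
    assert (Hse : sin e < e) by (apply sin_lt_x; lra).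
    assert (B : Rabs (h e) <= K' * exp ((1 - c) * ln (sin e))).
    { unfold h. rewrite Rabs_mult, (Rabs_right (exp _)) by (left; apply exp_pos).
      replace ((1 - c) * ln (sin e)) with (ln (sin e) + - c * ln (sin e)) by ring.
      rewrite exp_plus, exp_ln by exact Hs. rewrite <- Rmult_assoc.
      apply Rmult_le_compat_r; [left; apply exp_pos|].
      eapply Rle_trans; [apply HK; lra|].
      apply Rmult_le_compat_r; [lra|].
      unfold K'. generalize (Rle_abs K). lra. }
    assert (B2 : exp ((1 - c) * ln (sin e)) <= Rabs (h x) / (2 * K')).
    { assert (Hq : 0 < Rabs (h x) / (2 * K')) by (apply Rdiv_lt_0_compat; lra).
      rewrite <- (exp_ln (Rabs (h x) / (2 * K'))) by exact Hq.
      assert (L : ln (sin e) <= ln e3) by (apply ln_le; lra).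
      assert (L3 : (1 - c) * ln e3 = ln (Rabs (h x) / (2 * K'))).
      { unfold e3. rewrite ln_exp. field. lra. }
      rewrite <- L3.
      assert (L2 : (1 - c) * ln (sin e) <= (1 - c) * ln e3)
        by (apply Rmult_le_compat_l; lra).
      destruct L2 as [L2|L2]; [left; apply exp_increasing, L2 | right; now rewrite L2]. }
    rewrite (Hconst e) in B by lra.
    assert (B3 : K' * exp ((1 - c) * ln (sin e)) <= K' * (Rabs (h x) / (2 * K')))
      by (apply Rmult_le_compat_l; lra).
    replace (K' * (Rabs (h x) / (2 * K'))) with (Rabs (h x) / 2) in B3 by (field; lra).
    lra. }
  unfold h in Hh. apply Rmult_integral in Hh. destruct Hh as [Hh|Hh]; [exact Hh|].
  generalize (exp_pos (- c * ln (sin x))). lra.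
Qed.

(** The combinations [u + v] and [u - v] diagonalize the system: they solve
    [w' = a (cot x) w] and [w' = - a (cot x) w]. *)
Lemma cot_system_zero (a b : R) (u v : R -> R) :
  -1 < a < 1 -> b <= PI ->
  (forall x, 0 < x < b -> is_derive u x (a * (cos x / sin x) * v x)) ->
  (forall x, 0 < x < b -> is_derive v x (a * (cos x / sin x) * u x)) ->
  O_sin u -> O_sin v ->
  forall x, 0 < x < b -> u x = 0 /\ v x = 0.
Proof.
  intros Ha Hb Du Dv Su Sv x Hx.
  assert (D : forall s t, s * s = 1 -> 0 < t < b ->
     is_derive (fun t => 1 * u t + s * v t) t
       ((s * a) * (cos t / sin t) * (1 * u t + s * v t))).
  { intros s t Hs Ht. evar_last.
    - apply (is_derive_plus (fun t => 1 * u t) (fun t => s * v t)).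
      + apply (is_derive_scal u), Du, Ht.
      + apply (is_derive_scal v), Dv, Ht.
    - unfold plus, scal, mult; simpl. unfold mult; simpl.
      replace (s * a * (cos t / sin t) * (1 * u t + s * v t))
        with (a * (cos t / sin t) * (s * u t + (s * s) * v t)) by ring.
      rewrite Hs. ring. }
  assert (P : 1 * u x + 1 * v x = 0).
  { apply (cot_ode_zero (1 * a) b (fun t => 1 * u t + 1 * v t)); try lra.
    - intros t Ht. apply D; lra.
    - now apply O_sin_lin. }
  assert (N : 1 * u x + -1 * v x = 0).
  { apply (cot_ode_zero (-1 * a) b (fun t => 1 * u t + -1 * v t)); try lra.
    - intros t Ht. apply D; lra.
    - now apply O_sin_lin. }
  lra.
Qed.

(** * Power series in the sine *)

Lemma CV_radius_gt_of_bounded (c : nat -> R) (B x : R) :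
  (forall n, Rabs (c n) <= B) -> Rabs x < 1 -> Rbar_lt (Rabs x) (CV_radius c).
Proof.
  intros Hc Hx. apply Rbar_lt_le_trans with 1; [exact Hx|].
  apply (CV_radius_bounded c). exists B. intro n. rewrite pow1, Rmult_1_r. apply Hc.
Qed.

(** The Euler operator [x d/dx] multiplies the [n]-th coefficient by [n].  Along
    [x = sin z] it becomes [tan z d/dz], whence the cotangents below. *)
Lemma PSeries_euler (c : nat -> R) (x : R) :
  x * PSeries (PS_derive c) x = PSeries (fun n => INR n * c n) x.
Proof.
  rewrite <- PSeries_incr_1. apply PSeries_ext. intros [|n].
  - simpl. unfold zero; simpl. ring.
  - reflexivity.
Qed.

Lemma CV_radius_euler (c : nat -> R) :
  CV_radius (fun n => INR n * c n) = CV_radius c.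
Proof.
  rewrite <- (CV_radius_derive c), <- (CV_radius_incr_1 (PS_derive c)).
  apply CV_radius_ext. intros [|n].
  - simpl. unfold zero; simpl. ring.
  - reflexivity.
Qed.

Lemma Rabs_sin_lt_1 (z : R) : - (PI / 2) < z < PI / 2 -> Rabs (sin z) < 1.
Proof.
  intro Hz. apply Rabs_def1.
  - rewrite <- sin_PI2. apply sin_increasing_1; lra.
  - rewrite <- sin_PI2, <- sin_neg. apply sin_increasing_1; lra.
Qed.

Lemma is_derive_PSeries_sin (c : nat -> R) (z : R) :
  Rbar_lt (Rabs (sin z)) (CV_radius c) ->
  is_derive (fun t => PSeries c (sin t)) z (cos z * PSeries (PS_derive c) (sin z)).
Proof.
  intro H.
  apply (is_derive_comp (PSeries c) sin); [apply is_derive_PSeries, H | apply is_derive_sin].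
Qed.

Lemma is_derive_PSeries_sin_cot (c : nat -> R) (z : R) :
  sin z <> 0 -> Rbar_lt (Rabs (sin z)) (CV_radius c) ->
  is_derive (fun t => PSeries c (sin t)) z
    (cos z / sin z * PSeries (fun n => INR n * c n) (sin z)).
Proof.
  intros Hs H. evar_last; [apply is_derive_PSeries_sin, H|].
  rewrite <- PSeries_euler. now field.
Qed.

Lemma PSeries_even (c : nat -> R) (B x : R) :
  (forall n, Rabs (c n) <= B) -> Rabs x < 1 ->
  c 0%nat = 0 -> (forall n, c (2 * n + 1)%nat = 0) ->
  PSeries c x = Series (fun m => c (2 * S m)%nat * x ^ (2 * S m)).
Proof.
  intros HB Hx H0 Hodd.
  assert (Hx2 : Rabs (x ^ 2) < 1).
  { rewrite <- RPow_abs. generalize (Rabs_pos x). simpl. nra. }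
  assert (E : ex_pseries (fun n => c (2 * n)%nat) (x ^ 2)).
  { apply CV_radius_inside, (CV_radius_gt_of_bounded _ B); [intro; apply HB | exact Hx2]. }
  assert (O : ex_pseries (fun n => c (2 * n + 1)%nat) (x ^ 2)).
  { apply CV_radius_inside, (CV_radius_gt_of_bounded _ B); [intro; apply HB | exact Hx2]. }
  rewrite PSeries_odd_even by assumption.
  rewrite (PSeries_ext _ (fun _ => 0) (x ^ 2) Hodd), PSeries_const_0, Rmult_0_r, Rplus_0_r.
  unfold PSeries. rewrite Series_incr_1.
  - change (2 * 0)%nat with 0%nat. rewrite H0, Rmult_0_l, Rplus_0_l. apply Series_ext. intro n. now rewrite <- pow_mult.
  - apply ex_pseries_R in E. exact E.
Qed.

Lemma is_series_PSeries_odd (c : nat -> R) (B x : R) :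
  (forall n, Rabs (c n) <= B) -> Rabs x < 1 ->
  (forall n, c (2 * n)%nat = 0) ->
  is_series (fun n => c (2 * n + 1)%nat * x ^ (2 * n + 1)) (PSeries c x).
Proof.
  intros HB Hx Heven.
  assert (Hx2 : Rabs (x ^ 2) < 1).
  { rewrite <- RPow_abs. generalize (Rabs_pos x). simpl. nra. }
  assert (E : ex_pseries (fun n => c (2 * n)%nat) (x ^ 2)).
  { apply CV_radius_inside, (CV_radius_gt_of_bounded _ B); [intro; apply HB | exact Hx2]. }
  assert (O : ex_pseries (fun n => c (2 * n + 1)%nat) (x ^ 2)).
  { apply CV_radius_inside, (CV_radius_gt_of_bounded _ B); [intro; apply HB | exact Hx2]. }
  rewrite PSeries_odd_even by assumption.
  rewrite (PSeries_ext _ (fun _ => 0) (x ^ 2) Heven), PSeries_const_0, Rplus_0_l.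
  apply (is_series_ext (fun n => x * (c (2 * n + 1)%nat * (x ^ 2) ^ n))).
  { intro n. rewrite <- pow_mult, pow_add. simpl. ring. }
  apply (@is_series_scal R_AbsRing R_NormedModule x), Series_correct.
  apply ex_pseries_R in O. exact O.
Qed.

(** * Solutions of g'' = - a ^ 2 g expanded in the sine *)

Lemma sq_weight_bound (a : R) (n : nat) :
  -1 < a < 1 -> Rabs (INR n ^ 2 / (INR n ^ 2 - a ^ 2)) <= / (1 - a ^ 2).
Proof.
  intro Ha. assert (Hq : 0 < 1 - a ^ 2) by nra.
  destruct n as [|n].
  - simpl. rewrite Rmult_0_l. unfold Rdiv. rewrite Rmult_0_l, Rabs_R0.
    left. apply Rinv_0_lt_compat. simpl in Hq. exact Hq.
  - assert (Hn : 1 <= INR (S n)) by (apply (le_INR 1); lia).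
    revert Hn. generalize (INR (S n)). intros x Hx.
    rewrite Rabs_right by (left; apply Rdiv_lt_0_compat; nra).
    apply (Rmult_le_reg_r ((x ^ 2 - a ^ 2) * (1 - a ^ 2))); [apply Rmult_lt_0_compat; nra|].
    replace (x ^ 2 / (x ^ 2 - a ^ 2) * ((x ^ 2 - a ^ 2) * (1 - a ^ 2)))
      with (x ^ 2 * (1 - a ^ 2)) by (field; nra).
    replace (/ (1 - a ^ 2) * ((x ^ 2 - a ^ 2) * (1 - a ^ 2)))
      with (x ^ 2 - a ^ 2) by (field; nra).
    assert (0 <= a ^ 2 * (x ^ 2 - 1)) by (apply Rmult_le_pos; nra). nra.
Qed.

Lemma lin_weight_bound (a : R) (n : nat) :
  -1 < a < 1 -> Rabs (INR n / (INR n ^ 2 - a ^ 2)) <= / (1 - a ^ 2).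
Proof.
  intro Ha. destruct n as [|n].
  - simpl. unfold Rdiv. rewrite Rmult_0_l, Rabs_R0.
    left. apply Rinv_0_lt_compat. nra.
  - eapply Rle_trans; [|apply (sq_weight_bound a (S n) Ha)].
    assert (Hn : 1 <= INR (S n)) by (apply (le_INR 1); lia).
    revert Hn. generalize (INR (S n)). intros x Hx.
    unfold Rdiv. rewrite !Rabs_mult. apply Rmult_le_compat_r; [apply Rabs_pos|].
    rewrite !Rabs_right; nra.
Qed.

(** The Taylor coefficients in [x = sin z] of the solution of [g'' = - a ^ 2 g],
    namely [y0 * cos (a z) + y1 * sin (a z) / a].  The data [(1, 0)] give its
    even part, which leads to the first two identities, and [(0, 1)] its odd
    part, which leads to the last two. *)
Fixpoint sin_coef (a y0 y1 : R) (n : nat) : R :=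
  match n with
  | 0%nat => y0
  | 1%nat => y1
  | S (S k) => (INR k ^ 2 - a ^ 2) / (INR (S k) * INR (S (S k))) * sin_coef a y0 y1 k
  end.

Lemma two_step_ind (P : nat -> Prop) :
  P 0%nat -> P 1%nat -> (forall k, P k -> P (S (S k))) -> forall n, P n.
Proof.
  intros H0 H1 HS n. assert (H : P n /\ P (S n)); [|apply H].
  induction n as [|n [IH1 IH2]]; split; auto.
Qed.

(** The factor of the recurrence has absolute value at most [1], so the power
    series converges for [|x| < 1]. *)
Lemma sin_coef_bound (a y0 y1 : R) (n : nat) :
  -1 < a < 1 -> Rabs y0 <= 1 -> Rabs y1 <= 1 -> Rabs (sin_coef a y0 y1 n) <= 1.
Proof.
  intros Ha H0 H1. induction n as [| |k IH] using two_step_ind; [exact H0|exact H1|].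
  cbn [sin_coef]. rewrite Rabs_mult, <- (Rmult_1_l 1).
  apply Rmult_le_compat; try apply Rabs_pos; [|exact IH].
  rewrite !S_INR. generalize (INR k) (pos_INR k). intros x Hx.
  assert (Hp : 0 < (x + 1) * (x + 1 + 1)) by nra.
  unfold Rdiv. rewrite Rabs_mult, (Rabs_right (/ _))
    by (left; apply Rinv_0_lt_compat; exact Hp).
  apply (Rmult_le_reg_r ((x + 1) * (x + 1 + 1))); [exact Hp|].
  rewrite Rmult_assoc, Rinv_l, Rmult_1_r, Rmult_1_l by lra.
  apply Rabs_le. nra.
Qed.

Lemma sin_coef_odd_zero (a y0 : R) (n : nat) : sin_coef a y0 0 (2 * n + 1) = 0.
Proof.
  induction n as [|n IH]; [reflexivity|].
  replace (2 * S n + 1)%nat with (S (S (2 * n + 1))) by lia.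
  cbn [sin_coef]. rewrite IH. ring.
Qed.

Lemma sin_coef_even_zero (a y1 : R) (n : nat) : sin_coef a 0 y1 (2 * n) = 0.
Proof.
  induction n as [|n IH]; [reflexivity|].
  replace (2 * S n)%nat with (S (S (2 * n))) by lia.
  cbn [sin_coef]. rewrite IH. ring.
Qed.

Section SinExpansion.
Variables (a y0 y1 : R).
Hypotheses (Ha : -1 < a < 1) (H0 : Rabs y0 <= 1) (H1 : Rabs y1 <= 1).
Let y := sin_coef a y0 y1.

Lemma sin_coef_radius (x : R) : Rabs x < 1 -> Rbar_lt (Rabs x) (CV_radius y).
Proof.
  apply (CV_radius_gt_of_bounded y 1). intro n. now apply sin_coef_bound.
Qed.

(** Comparing coefficients, this is the recurrence
    [(n + 1) (n + 2) y_(n+2) = (n ^ 2 - a ^ 2) y_n]. *)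
Lemma sin_coef_ode (x : R) : Rabs x < 1 ->
  (1 - x ^ 2) * PSeries (PS_derive (PS_derive y)) x
    - x * PSeries (PS_derive y) x + a ^ 2 * PSeries y x = 0.
Proof.
  intro Hx.
  assert (R0 := sin_coef_radius x Hx).
  assert (E0 := CV_radius_inside y x R0).
  assert (E2 : ex_pseries (fun n => INR n * (INR n * y n)) x).
  { apply CV_radius_inside. now rewrite CV_radius_euler, CV_radius_euler. }
  assert (Hxx : x ^ 2 * PSeries (PS_derive (PS_derive y)) x
     = PSeries (fun n => INR n * (INR n * y n)) x - x * PSeries (PS_derive y) x).
  { rewrite PSeries_euler. simpl pow. rewrite Rmult_1_r, Rmult_assoc, PSeries_euler.
    rewrite <- PSeries_incr_1.
    assert (E1 : ex_pseries (fun n => INR n * y n) x).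
    { apply CV_radius_inside. now rewrite CV_radius_euler. }
    rewrite <- PSeries_minus by assumption.
    apply PSeries_ext. intros [|n].
    - unfold PS_minus, PS_plus, PS_opp, PS_incr_1, opp, plus, zero; simpl. ring.
    - unfold PS_minus, PS_plus, PS_opp, PS_incr_1, PS_derive, opp, plus.
      cbn -[INR]. rewrite S_INR. ring. }
  assert (HY : PSeries (PS_derive (PS_derive y)) x
     = PSeries (fun n => INR n * (INR n * y n)) x - a ^ 2 * PSeries y x).
  { rewrite <- PSeries_scal, <- PSeries_minus by
      (assumption || (apply ex_pseries_scal; [apply Rmult_comm | assumption])).
    apply PSeries_ext. intro n.
    unfold PS_minus, PS_plus, PS_opp, PS_scal, PS_derive, opp, plus, scal.
    unfold y. cbn -[INR]. unfold mult; cbn -[INR].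
    field. split; apply not_0_INR; lia. }
  lra.
Qed.

(** With [g z] the sum of the power series at [sin z], the differential equation
    above reads [g'' = - a ^ 2 g].  The differences [p] and [q] between [g'],
    [a g] and their expected values satisfy [p' = - a q] and [q' = a p], so the
    energy [p ^ 2 + q ^ 2] is constant, and it vanishes at [0].  Using [a g]
    instead of [g] covers [a = 0] as well. *)
Lemma derive_PSeries_sin_coef (z : R) : 0 <= z < PI / 2 ->
  cos z * PSeries (PS_derive y) (sin z) = y1 * cos (a * z) - a * y0 * sin (a * z).
Proof.
  intro Hz.
  set (Y := fun t => PSeries y (sin t)).
  set (Y' := fun t => cos t * PSeries (PS_derive y) (sin t)).
  set (p := fun t => Y' t - y1 * cos (a * t) + a * y0 * sin (a * t)).
  set (q := fun t => a * Y t - a * y0 * cos (a * t) - y1 * sin (a * t)).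
  assert (HPI := PI_RGT_0).
  assert (DY : forall t, 0 <= t <= z -> is_derive Y t (Y' t)).
  { intros t Ht. apply is_derive_PSeries_sin, sin_coef_radius, Rabs_sin_lt_1. lra. }
  assert (DY' : forall t, 0 <= t <= z -> is_derive Y' t (- a ^ 2 * Y t)).
  { intros t Ht.
    assert (Hs : Rabs (sin t) < 1) by (apply Rabs_sin_lt_1; lra).
    evar_last.
    - apply (is_derive_mult cos (fun t => PSeries (PS_derive y) (sin t)));
        [apply is_derive_cos | | exact Rmult_comm].
      apply is_derive_PSeries_sin. rewrite CV_radius_derive. apply sin_coef_radius, Hs.
    - generalize (sin_coef_ode (sin t) Hs) (sin2_cos2 t). unfold Y, Rsqr, plus, mult; simpl.
      intros O C.
      replace (sin t * (sin t * 1)) with (1 - cos t * cos t) in O by lra. lra. }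
  assert (Dp : forall t, 0 <= t <= z -> is_derive p t (- a * q t)).
  { intros t Ht. unfold p.
    evar_last.
    - apply (is_derive_plus (fun t => Y' t - y1 * cos (a * t)) (fun t => a * y0 * sin (a * t))).
      + apply (is_derive_minus Y' (fun t => y1 * cos (a * t))); [apply DY', Ht|].
        auto_derive; [exact I | reflexivity].
      + auto_derive; [exact I | reflexivity].
    - unfold q, minus, plus, opp; simpl. ring. }
  assert (Dq : forall t, 0 <= t <= z -> is_derive q t (a * p t)).
  { intros t Ht. unfold q.
    evar_last.
    - apply (is_derive_minus (fun t => a * Y t - a * y0 * cos (a * t)) (fun t => y1 * sin (a * t))).
      + apply (is_derive_minus (fun t => a * Y t) (fun t => a * y0 * cos (a * t))).
        * apply (is_derive_scal Y), DY, Ht.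
        * auto_derive; [exact I | reflexivity].
      + auto_derive; [exact I | reflexivity].
    - unfold p, minus, plus, opp, scal, mult; simpl. ring. }
  set (W := fun t => p t * p t + q t * q t).
  assert (W0 : W 0 = 0).
  { unfold W, p, q, Y, Y'.
    rewrite !Rmult_0_r, sin_0, cos_0, !PSeries_0. unfold PS_derive. simpl. fold y.
    unfold y; simpl. ring. }
  assert (Wz : W z = 0).
  { destruct (Rle_lt_or_eq_dec 0 z (proj1 Hz)) as [Hz0|<-]; [|exact W0].
    rewrite <- W0. symmetry. apply (eq_is_derive W 0 z); [|exact Hz0].
    intros t Ht. unfold W. evar_last.
    - apply (is_derive_plus (fun t => p t * p t) (fun t => q t * q t)).
      + apply (is_derive_mult p p); [apply Dp, Ht | apply Dp, Ht | exact Rmult_comm].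
      + apply (is_derive_mult q q); [apply Dq, Ht | apply Dq, Ht | exact Rmult_comm].
    - unfold plus, mult, zero; simpl. ring. }
  assert (Hp : p z = 0) by (unfold W in Wz; nra).
  unfold p, Y' in Hp. lra.
Qed.

(** The summands of the left-hand sides are these coefficients, or [n] times
    them, up to constant factors. *)
Definition weighted_coef (n : nat) : R := INR n * sin_coef a y0 y1 n / (INR n ^ 2 - a ^ 2).

Lemma weighted_coef_bound (n : nat) : Rabs (weighted_coef n) <= / (1 - a ^ 2).
Proof.
  unfold weighted_coef.
  replace (_ / _) with (INR n / (INR n ^ 2 - a ^ 2) * sin_coef a y0 y1 n)
    by (unfold Rdiv; ring).
  rewrite Rabs_mult, <- (Rmult_1_r (/ _)).
  apply Rmult_le_compat; try apply Rabs_pos; [now apply lin_weight_bound | now apply sin_coef_bound].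
Qed.

Lemma euler_weighted_coef_bound (n : nat) :
  Rabs (INR n * weighted_coef n) <= / (1 - a ^ 2).
Proof.
  unfold weighted_coef.
  replace (_ * _) with (INR n ^ 2 / (INR n ^ 2 - a ^ 2) * sin_coef a y0 y1 n)
    by (unfold Rdiv; ring).
  rewrite Rabs_mult, <- (Rmult_1_r (/ _)).
  apply Rmult_le_compat; try apply Rabs_pos; [now apply sq_weight_bound | now apply sin_coef_bound].
Qed.

Lemma sq_minus_sq_neq_0 (n : nat) : INR (S n) ^ 2 - a ^ 2 <> 0.
Proof.
  assert (1 <= INR (S n)) by (apply (le_INR 1); lia). nra.
Qed.

Lemma is_derive_weighted (z : R) : 0 < z < PI / 2 ->
  is_derive (fun t => PSeries weighted_coef (sin t)) z
    (cos z / sin z * PSeries (fun n => INR n * weighted_coef n) (sin z)).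
Proof.
  intro Hz. apply is_derive_PSeries_sin_cot.
  - apply Rgt_not_eq, sin_gt_0; lra.
  - apply (CV_radius_gt_of_bounded _ _ _ weighted_coef_bound), Rabs_sin_lt_1. lra.
Qed.

(** The relation [n ^ 3 / (n ^ 2 - a ^ 2) = n + a ^ 2 * n / (n ^ 2 - a ^ 2)] turns
    the derivative into the derivative of the solution of [g'' = - a ^ 2 g], which
    is explicit, plus a multiple of the weighted series. *)
Lemma is_derive_euler_weighted (z : R) : 0 < z < PI / 2 ->
  is_derive (fun t => PSeries (fun n => INR n * weighted_coef n) (sin t)) z
    (y1 * cos (a * z) - a * y0 * sin (a * z)
     + a ^ 2 * (cos z / sin z * PSeries weighted_coef (sin z))).
Proof.
  intro Hz.
  assert (Hs : 0 < sin z) by (apply sin_gt_0; lra).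
  assert (Hs1 : Rabs (sin z) < 1) by (apply Rabs_sin_lt_1; lra).
  evar_last.
  { apply is_derive_PSeries_sin_cot; [lra|].
    apply (CV_radius_gt_of_bounded _ _ _ euler_weighted_coef_bound), Hs1. }
  rewrite (PSeries_ext _ (PS_plus (fun n => INR n * y n) (PS_scal (a ^ 2) weighted_coef))).
  - rewrite PSeries_plus, PSeries_scal, <- PSeries_euler, <- derive_PSeries_sin_coef by
      (lra || (apply CV_radius_inside; rewrite CV_radius_euler; now apply sin_coef_radius)
       || (apply ex_pseries_scal; [apply Rmult_comm|]; apply CV_radius_inside;
           now apply (CV_radius_gt_of_bounded _ _ _ weighted_coef_bound))).
    field. lra.
  - intros [|n]; unfold PS_plus, PS_scal, plus, scal, weighted_coef; cbn -[INR sin_coef pow];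
      unfold mult; cbn -[INR sin_coef pow].
    + simpl. unfold Rdiv. ring.
    + unfold y. field. apply sq_minus_sq_neq_0.
Qed.

Lemma PSeries_sin_small (c : nat -> R) (B : R) :
  c 0%nat = 0 -> (forall n, Rabs (c n) <= B) ->
  O_sin (fun z => PSeries c (sin z)).
Proof.
  intros Hc0 HB. exists (2 * B), (1 / 2). split; [lra|]. intros z Hz.
  assert (Hs : 0 < sin z) by (apply sin_gt_0; generalize PI2_3_2; lra).
  assert (Hs1 : sin z < z) by (apply sin_lt_x; lra).
  rewrite PSeries_decr_1.
  - rewrite Hc0, Rplus_0_l. unfold PSeries. rewrite <- Series_scal_l.
    apply Series_geom_dominated; [lra|].
    intro n. unfold PS_decr_1.
    replace (sin z * (c (S n) * sin z ^ n)) with (c (S n) * sin z ^ S n) by (simpl; ring).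
    rewrite Rabs_mult, (Rabs_right (_ ^ _)) by (left; apply pow_lt, Hs).
    apply Rmult_le_compat_r; [left; apply pow_lt, Hs | apply HB].
  - apply CV_radius_inside, (CV_radius_gt_of_bounded _ _ _ HB). rewrite Rabs_right; lra.
Qed.
End SinExpansion.

(** * Closed forms of the coefficients *)

Lemma Rprod_S (m n : nat) (f : nat -> R) : (m <= n)%nat ->
  Rprod m (S n) f = Rprod m n f * f n.
Proof.
  intro H. unfold Rprod. replace (S n - m)%nat with (S (n - m)) by lia.
  rewrite seq_S, map_app. replace (m + (n - m))%nat with n by lia. simpl.
  generalize (map f (seq m (n - m))). intro l.
  induction l as [|x l IH]; simpl; [ring|]. rewrite IH. ring.
Qed.

Lemma binom_central_S (n : nat) :
  binom (2 * S n) (S n) = binom (2 * n) n * (2 * INR (2 * n + 1) / INR (S n)).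
Proof.
  unfold binom, Binomial.C.
  replace (2 * S n - S n)%nat with (S n) by lia.
  replace (2 * n - n)%nat with n by lia.
  replace (2 * S n)%nat with (S (S (2 * n))) by lia.
  replace (2 * n + 1)%nat with (S (2 * n)) by lia.
  rewrite !fact_simpl, !mult_INR.
  replace (INR (S (S (2 * n)))) with (2 * INR (S n)) by (rewrite !S_INR, mult_INR; simpl; ring).
  field. split; [apply not_0_INR; lia | apply INR_fact_neq_0].
Qed.

Lemma binom_central_ge_1 (n : nat) : 1 <= binom (2 * n) n.
Proof.
  induction n as [|n IH].
  - unfold binom, Binomial.C. simpl. lra.
  - rewrite binom_central_S, <- (Rmult_1_l 1).
    apply Rmult_le_compat; try lra.
    rewrite plus_INR, mult_INR, (S_INR n). simpl. generalize (pos_INR n). intro.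
    apply (Rmult_le_reg_r (INR n + 1)); [lra|].
    unfold Rdiv. rewrite !Rmult_assoc, Rinv_l; lra.
Qed.

Lemma sin_coef_even (a : R) (m : nat) :
  sin_coef a 1 0 (2 * S m)
  = - (a ^ 2 / 4) * (4 ^ S m / (INR (S m) ^ 2 * binom (2 * S m) (S m)))
    * Rprod 1 (S m) (fun k => 1 - a ^ 2 / INR (2 * k) ^ 2).
Proof.
  induction m as [|m IH].
  - unfold binom, Binomial.C, Rprod. simpl. field.
  - replace (2 * S (S m))%nat with (S (S (2 * S m))) at 1 by lia.
    cbn [sin_coef]. rewrite IH, (Rprod_S 1 (S m)), (binom_central_S (S m)) by lia.
    generalize (binom_central_ge_1 (S m)). generalize (binom (2 * S m) (S m)). intros b Hb.
    generalize (Rprod 1 (S m) (fun k => 1 - a ^ 2 / INR (2 * k) ^ 2)). intro P.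
    rewrite <- (tech_pow_Rmult 4 (S m)). generalize (4 ^ S m). intro F.
    rewrite ?S_INR, ?plus_INR, ?mult_INR, ?S_INR. generalize (pos_INR m).
    simpl (INR 0); simpl (INR 1). generalize (INR m). intros x Hx.
    field. repeat split; lra.
Qed.

Lemma sin_coef_odd (a : R) (n : nat) :
  sin_coef a 0 1 (2 * n + 1)
  = binom (2 * n) n / (2 ^ (2 * n) * INR (2 * n + 1))
    * Rprod 0 n (fun k => 1 - a ^ 2 / INR (2 * k + 1) ^ 2).
Proof.
  induction n as [|n IH].
  - unfold binom, Binomial.C, Rprod. simpl. field.
  - replace (2 * S n + 1)%nat with (S (S (2 * n + 1))) at 1 by lia.
    cbn [sin_coef]. rewrite IH, Rprod_S, (binom_central_S n) by lia.
    generalize (binom (2 * n) n). intro b.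
    generalize (Rprod 0 n (fun k => 1 - a ^ 2 / INR (2 * k + 1) ^ 2)). intro P.
    replace (2 * S n)%nat with (S (S (2 * n))) by lia.
    rewrite <- !tech_pow_Rmult.
    generalize (pow_nonzero 2 (2 * n) ltac:(lra)). generalize (2 ^ (2 * n)). intros F HF.
    rewrite ?S_INR, ?plus_INR, ?S_INR, ?mult_INR. generalize (pos_INR n).
    simpl (INR 0); simpl (INR 1); simpl (INR 2). generalize (INR n). intros x Hx.
    field. repeat split; lra.
Qed.

Lemma pow_even_2mul (s : R) (n : nat) : (2 * s) ^ (2 * n) = 4 ^ n * s ^ (2 * n).
Proof. rewrite Rpow_mult_distr, (pow_mult 2). f_equal. f_equal. ring. Qed.

Lemma even_term1_weighted (a z : R) (m : nat) : -1 < a < 1 ->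
  a ^ 2 * even_term1 a z (S m)
  = - 2 * (weighted_coef a 1 0 (2 * S m) * sin z ^ (2 * S m)).
Proof.
  intro Ha. unfold even_term1, weighted_coef. rewrite sin_coef_even, pow_even_2mul.
  generalize (sq_minus_sq_neq_0 a Ha (S (2 * m))).
  replace (S (S (2 * m))) with (2 * S m)%nat by lia.
  generalize (binom_central_ge_1 (S m)). generalize (binom (2 * S m) (S m)). intros b Hb.
  generalize (Rprod 1 (S m) (fun k => 1 - a ^ 2 / INR (2 * k) ^ 2)). intro P.
  generalize (sin z ^ (2 * S m)) (4 ^ S m). intros s f.
  rewrite mult_INR. assert (INR (S m) <> 0) by (apply not_0_INR; lia).
  replace (INR 2) with 2 by reflexivity. intro Hq. field. repeat split; lra.
Qed.

Lemma even_term1_term2 (a z : R) (m : nat) :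
  even_term1 a z (S m) = / INR (S m) * even_term2 a z (S m).
Proof.
  unfold even_term1, even_term2, Rdiv. rewrite !Rinv_mult. ring.
Qed.

Lemma even_term2_euler_weighted (a z : R) (m : nat) : -1 < a < 1 ->
  a ^ 2 * even_term2 a z (S m)
  = - (INR (2 * S m) * weighted_coef a 1 0 (2 * S m) * sin z ^ (2 * S m)).
Proof.
  intro Ha.
  replace (even_term2 a z (S m)) with (INR (S m) * even_term1 a z (S m)).
  - replace (a ^ 2 * _) with (INR (S m) * (a ^ 2 * even_term1 a z (S m))) by ring.
    rewrite even_term1_weighted by exact Ha. rewrite mult_INR. simpl (INR 2). ring.
  - rewrite even_term1_term2. field. apply not_0_INR. lia.
Qed.

Lemma odd_term2_weighted (a z : R) (n : nat) :
  odd_term2 a z n = weighted_coef a 0 1 (2 * n + 1) * sin z ^ (2 * n + 1).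
Proof.
  unfold odd_term2, weighted_coef. rewrite sin_coef_odd. unfold Rdiv. rewrite !Rinv_mult.
  assert (INR (2 * n + 1) <> 0) by (apply not_0_INR; lia).
  generalize (/ (INR (2 * n + 1) ^ 2 - a ^ 2)) (/ 2 ^ (2 * n)). intros.
  field. assumption.
Qed.

Lemma odd_term1_euler_weighted (a z : R) (n : nat) :
  odd_term1 a z n
  = INR (2 * n + 1) * weighted_coef a 0 1 (2 * n + 1) * sin z ^ (2 * n + 1).
Proof.
  rewrite Rmult_assoc, <- odd_term2_weighted. unfold odd_term1, odd_term2.
  unfold Rdiv. ring.
Qed.

Lemma Rprod_Rabs_le_1 (m n : nat) (f : nat -> R) :
  (forall k, (m <= k)%nat -> Rabs (f k) <= 1) -> Rabs (Rprod m n f) <= 1.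
Proof.
  unfold Rprod. generalize (n - m)%nat. intro l. revert m.
  induction l as [|l IH]; intros m Hf; simpl; [rewrite Rabs_R1; lra|].
  rewrite Rabs_mult. apply Rle_trans with (1 * 1); [|lra].
  apply Rmult_le_compat; try apply Rabs_pos.
  - apply Hf; lia.
  - apply IH. intros k Hk. apply Hf. lia.
Qed.

(** Crude, but enough since [2 * sin z < 1]: the binomial coefficient is at least
    [1] and the product at most [1].  Unlike the comparison with [weighted_coef],
    it also gives convergence when [a = 0]. *)
Lemma even_term2_bound (a z : R) (m : nat) : -1 < a < 1 -> 0 <= 2 * sin z < 1 ->
  Rabs (even_term2 a z (S m)) <= / (1 - a ^ 2) * (2 * sin z) ^ S m.
Proof.
  intros Ha Hz. unfold even_term2.
  set (P := Rprod _ _ _).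
  assert (HP : Rabs P <= 1).
  { apply Rprod_Rabs_le_1. intros k Hk.
    assert (Hx : 1 <= INR (2 * k)) by (apply (le_INR 1); lia).
    assert (Hi : 0 < / INR (2 * k) ^ 2 <= 1).
    { split; [apply Rinv_0_lt_compat; nra|]. rewrite <- Rinv_1. apply Rinv_le_contravar; nra. }
    unfold Rdiv. apply Rabs_le. nra. }
  assert (Hb := binom_central_ge_1 (S m)).
  assert (Hx : 1 <= INR (2 * S m)) by (apply (le_INR 1); lia).
  assert (Hp : 0 <= (2 * sin z) ^ (2 * S m)) by (apply pow_le; lra).
  assert (Hpow : (2 * sin z) ^ (2 * S m) <= (2 * sin z) ^ S m).
  { replace (2 * S m)%nat with (S m + S m)%nat by lia. rewrite pow_add.
    rewrite <- (Rmult_1_r ((2 * sin z) ^ S m)) at 3.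
    apply Rmult_le_compat_l; [apply pow_le; lra|].
    rewrite <- (pow1 (S m)). apply pow_incr. lra. }
  assert (Hq : 0 < 1 - a ^ 2) by nra.
  assert (Hd : 1 - a ^ 2 <= binom (2 * S m) (S m) * (INR (2 * S m) ^ 2 - a ^ 2)).
  { apply Rle_trans with (1 * (INR (2 * S m) ^ 2 - a ^ 2)); [nra|].
    apply Rmult_le_compat_r; nra. }
  rewrite Rabs_mult, <- (Rmult_1_r (_ * _ ^ S m)).
  apply Rmult_le_compat; try apply Rabs_pos; [|exact HP].
  set (D := binom (2 * S m) (S m) * (INR (2 * S m) ^ 2 - a ^ 2)) in *.
  assert (HD : 0 < / D <= / (1 - a ^ 2)).
  { split; [apply Rinv_0_lt_compat; lra | apply Rinv_le_contravar; lra]. }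
  rewrite Rabs_right.
  - unfold Rdiv. rewrite Rmult_comm. apply Rmult_le_compat; lra.
  - apply Rle_ge, Rmult_le_pos; lra.
Qed.

Lemma ex_series_even_terms (a z : R) : -1 < a < 1 -> 0 <= 2 * sin z < 1 ->
  ex_series (fun m => even_term1 a z (S m)) /\ ex_series (fun m => even_term2 a z (S m)).
Proof.
  intros Ha Hz.
  split; apply (ex_series_geom_dominated _ (/ (1 - a ^ 2)) (2 * sin z)); try exact Hz; intro m.
  - eapply Rle_trans; [|now apply even_term2_bound].
    rewrite even_term1_term2, Rabs_mult, <- Rmult_1_l.
    apply Rmult_le_compat_r; [apply Rabs_pos|].
    assert (1 <= INR (S m)) by (apply (le_INR 1); lia).
    rewrite Rabs_right by (left; apply Rinv_0_lt_compat; lra).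
    rewrite <- Rinv_1. apply Rinv_le_contravar; lra.
  - now apply even_term2_bound.
Qed.

(** * Series in powers of 1 - exp (- 2 i z) *)

(** That is, [1 - exp (- 2 i z) = 2 i (sin z) exp (- i z)], of modulus
    [2 * |sin z|]. *)
Lemma base_eq (z : R) : base z = (2 * sin z ^ 2, 2 * sin z * cos z).
Proof.
  unfold base, Cexp, Cminus, Cplus, Copp, Cmult, Ci, RtoC, Re, Im. cbn [fst snd].
  replace (- ((2 * 0 - 0 * 1) * z - (2 * 1 + 0 * 0) * 0)) with 0 by ring.
  replace (- ((2 * 0 - 0 * 1) * 0 + (2 * 1 + 0 * 0) * z)) with (- (2 * z)) by ring.
  rewrite exp_0, cos_neg, sin_neg, cos_2a_sin, sin_2a.
  f_equal; ring.
Qed.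

Lemma Cmod_base (z : R) : 0 <= sin z -> Cmod (base z) = 2 * sin z.
Proof.
  intro Hs. rewrite base_eq. unfold Cmod. cbn [fst snd].
  replace (_ + _) with ((2 * sin z) ^ 2).
  - apply sqrt_pow2. lra.
  - generalize (sin2_cos2 z). unfold Rsqr. intro E.
    replace ((2 * sin z) ^ 2) with ((2 * sin z) ^ 2 * (sin z * sin z + cos z * cos z))
      by (rewrite E; ring). ring.
Qed.

(** The logarithmic derivative of the base is [cot z - i]. *)
Lemma is_derive_base_pow (n : nat) (z : R) : sin z <> 0 ->
  is_derive (fun t => Re (base t ^ n)%C) z
    (INR n * (cos z / sin z * Re (base z ^ n)%C + Im (base z ^ n)%C)) /\
  is_derive (fun t => Im (base t ^ n)%C) z
    (INR n * (cos z / sin z * Im (base z ^ n)%C - Re (base z ^ n)%C)).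
Proof.
  intro Hs. induction n as [|n [IHr IHi]].
  - split; simpl; rewrite Rmult_0_l; apply @is_derive_const.
  - assert (Db1 : is_derive (fun t => 2 * sin t ^ 2) z (4 * sin z * cos z)).
    { auto_derive; [exact I | ring]. }
    assert (Db2 : is_derive (fun t => 2 * sin t * cos t) z (2 * cos z ^ 2 - 2 * sin z ^ 2)).
    { auto_derive; [exact I | ring]. }
    rewrite S_INR. split.
    + apply (is_derive_ext (fun t => 2 * sin t ^ 2 * Re (base t ^ n)%C
                                     - 2 * sin t * cos t * Im (base t ^ n)%C)).
      { intro t. rewrite Cpow_S, base_eq. reflexivity. }
      evar_last.
      * apply (is_derive_minus (fun t => 2 * sin t ^ 2 * Re (base t ^ n)%C)
                 (fun t => 2 * sin t * cos t * Im (base t ^ n)%C)).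
        -- apply (is_derive_mult (fun t => 2 * sin t ^ 2) _ z _ _ Db1 IHr Rmult_comm).
        -- apply (is_derive_mult (fun t => 2 * sin t * cos t) _ z _ _ Db2 IHi Rmult_comm).
      * rewrite Cpow_S, base_eq.
        generalize (Cpow (2 * sin z ^ 2, 2 * sin z * cos z) n). intros [p q].
        unfold minus, plus, opp, mult, Cmult, Re, Im; simpl. field. exact Hs.
    + apply (is_derive_ext (fun t => 2 * sin t ^ 2 * Im (base t ^ n)%C
                                     + 2 * sin t * cos t * Re (base t ^ n)%C)).
      { intro t. rewrite Cpow_S, base_eq. reflexivity. }
      evar_last.
      * apply (is_derive_plus (fun t => 2 * sin t ^ 2 * Im (base t ^ n)%C)
                 (fun t => 2 * sin t * cos t * Re (base t ^ n)%C)).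
        -- apply (is_derive_mult (fun t => 2 * sin t ^ 2) _ z _ _ Db1 IHi Rmult_comm).
        -- apply (is_derive_mult (fun t => 2 * sin t * cos t) _ z _ _ Db2 IHr Rmult_comm).
      * rewrite Cpow_S, base_eq.
        generalize (Cpow (2 * sin z ^ 2, 2 * sin z * cos z) n). intros [p q].
        unfold minus, plus, opp, mult, Cmult, Re, Im; simpl. field. exact Hs.
Qed.

Lemma im_le_Cmod (w : C) : Rabs (Im w) <= Cmod w.
Proof.
  eapply Rle_trans; [apply Rmax_r | apply (Rmax_Cmod w)].
Qed.

Definition re_base_series (c : nat -> R) (z : R) : R :=
  Series (fun m => c (S m) * Re (base z ^ S m)%C).
Definition im_base_series (c : nat -> R) (z : R) : R :=
  Series (fun m => c (S m) * Im (base z ^ S m)%C).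

Section BaseSeries.
Variables (c : nat -> R) (K : R).
Hypothesis HK : forall n, Rabs (c (S n)) <= K.

Lemma base_term_bound (z : R) (n : nat) : 0 <= sin z ->
  Rabs (c (S n) * Re (base z ^ S n)%C) <= K * (2 * sin z) ^ S n /\
  Rabs (c (S n) * Im (base z ^ S n)%C) <= K * (2 * sin z) ^ S n.
Proof.
  intro Hs. rewrite <- Cmod_base by exact Hs. rewrite <- Cmod_pow, !Rabs_mult.
  split; apply Rmult_le_compat; try apply Rabs_pos; try apply HK.
  - apply re_le_Cmod.
  - apply im_le_Cmod.
Qed.

Lemma ex_base_series (z : R) : 0 <= 2 * sin z < 1 ->
  ex_series (fun m => c (S m) * Re (base z ^ S m)%C) /\
  ex_series (fun m => c (S m) * Im (base z ^ S m)%C).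
Proof.
  intro Hz. split; apply (ex_series_geom_dominated _ K (2 * sin z) Hz); intro n;
    apply base_term_bound; lra.
Qed.

Lemma base_series_small :
  O_sin (re_base_series c) /\ O_sin (im_base_series c).
Proof.
  split; exists (4 * K), (1 / 4); (split; [lra|]); intros z Hz;
    assert (Hs : 0 < sin z) by (apply sin_gt_0; generalize PI2_3_2; lra);
    assert (Hs1 : sin z < z) by (apply sin_lt_x; lra);
    replace (4 * K * sin z) with (2 * K * (2 * sin z)) by ring;
    apply Series_geom_dominated; try lra; intro n; apply base_term_bound; lra.
Qed.
End BaseSeries.

Lemma two_sin_bound (z : R) : 0 < z < PI / 6 -> 0 < sin z /\ 2 * sin z < 1.
Proof.
  intro Hz. assert (HPI := PI_RGT_0). split; [apply sin_gt_0; lra|].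
  assert (sin z < sin (PI / 6)) by (apply sin_increasing_1; lra).
  rewrite sin_PI6 in *. lra.
Qed.

(** Termwise differentiation on a neighbourhood of [z] that stays away from [0],
    where the cotangent is unbounded, and from [PI / 6], where the modulus of
    the base reaches [1]. *)
Lemma is_derive_base_series (c : nat -> R) (K z : R) :
  (forall n, Rabs (INR (S n) * c (S n)) <= K) -> 0 < z < PI / 6 ->
  is_derive (re_base_series c) z
    (cos z / sin z * re_base_series (fun n => INR n * c n) z
     + im_base_series (fun n => INR n * c n) z) /\
  is_derive (im_base_series c) z
    (cos z / sin z * im_base_series (fun n => INR n * c n) z
     - re_base_series (fun n => INR n * c n) z).
Proof.
  intros HK Hz. assert (HPI := PI_RGT_0).
  set (lo := z / 2). set (hi := (z + PI / 6) / 2).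
  assert (Hin : lo < z < hi) by (unfold lo, hi; lra).
  assert (Hloc : forall x, lo < x < hi -> 0 < x < PI / 6) by (unfold lo, hi; intros; lra).
  destruct (two_sin_bound hi) as [Hh0 Hh1]; [unfold hi; lra|].
  assert (Hlo : 0 < sin lo) by (apply sin_gt_0; unfold lo; lra).
  set (r := 2 * sin hi).
  set (Q := / sin lo + 1).
  assert (HQ : 1 < Q) by (unfold Q; generalize (Rinv_0_lt_compat _ Hlo); lra).
  assert (HK0 : 0 <= K) by (eapply Rle_trans; [apply Rabs_pos | apply (HK 0%nat)]).
  assert (HKc : forall n, Rabs (c (S n)) <= K).
  { intro n. eapply Rle_trans; [|apply HK]. rewrite Rabs_mult, <- (Rmult_1_l (Rabs (c (S n)))) at 1.
    apply Rmult_le_compat_r; [apply Rabs_pos|].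
    assert (1 <= INR (S n)) by (apply (le_INR 1); lia). rewrite Rabs_right; lra. }
  set (M := fun n => Q * K * r ^ S n).
  assert (ExM : ex_series M).
  { apply (ex_series_geom_dominated _ (Q * K) r); [unfold r; lra|].
    intro n. unfold M. rewrite Rabs_right; [lra|].
    apply Rle_ge, Rmult_le_pos; [nra | apply pow_le; unfold r; lra]. }
  assert (Hpow : forall x n, lo < x < hi -> 0 < sin x /\ (2 * sin x) ^ S n <= r ^ S n).
  { intros x n Hx. destruct (two_sin_bound x (Hloc x Hx)) as [Hx0 Hx1]. split; [exact Hx0|].
    apply pow_incr. unfold r.
    assert (sin x < sin hi) by (apply sin_increasing_1; unfold lo, hi in *; lra). lra. }
  assert (Bf : forall x n, lo < x < hi ->
     Rabs (c (S n) * Re (base x ^ S n)%C) <= M n /\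
     Rabs (c (S n) * Im (base x ^ S n)%C) <= M n).
  { intros x n Hx. destruct (Hpow x n Hx) as [Hs Hp].
    assert (HM : K * (2 * sin x) ^ S n <= M n).
    { unfold M. assert (0 <= r ^ S n) by (apply pow_le; unfold r; lra).
      apply Rle_trans with (K * r ^ S n); [apply Rmult_le_compat_l; lra|].
      apply Rmult_le_compat_r; nra. }
    destruct (base_term_bound c K HKc x n) as [B1 B2]; [lra|]. split; lra. }
  assert (Hcot : forall x, lo < x < hi -> Rabs (cos x / sin x) <= / sin lo).
  { intros x Hx. destruct (Hpow x 0%nat Hx) as [Hs _].
    assert (sin lo < sin x) by (apply sin_increasing_1; unfold lo, hi in *; lra).
    unfold Rdiv. rewrite Rabs_mult, <- (Rmult_1_l (/ sin lo)).
    apply Rmult_le_compat; try apply Rabs_pos.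
    - apply Rabs_le, COS_bound.
    - rewrite Rabs_right by (left; now apply Rinv_0_lt_compat).
      apply Rinv_le_contravar; lra. }
  assert (Bg : forall x n e, lo < x < hi -> Rabs e <= 1 ->
     Rabs (INR (S n) * c (S n) * (cos x / sin x * Re (base x ^ S n)%C + e * Im (base x ^ S n)%C)) <= M n
     /\ Rabs (INR (S n) * c (S n) * (cos x / sin x * Im (base x ^ S n)%C + e * Re (base x ^ S n)%C)) <= M n).
  { intros x n e Hx He. destruct (Hpow x n Hx) as [Hs Hp].
    assert (Aux : forall p q, Rabs p <= (2 * sin x) ^ S n -> Rabs q <= (2 * sin x) ^ S n ->
       Rabs (INR (S n) * c (S n) * (cos x / sin x * p + e * q)) <= M n).
    { intros p q Hpp Hq. unfold M. rewrite Rabs_mult, (Rmult_comm Q), Rmult_assoc.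
      apply Rmult_le_compat; try apply Rabs_pos; [apply HK|].
      eapply Rle_trans; [apply Rabs_triang|]. rewrite !Rabs_mult.
      unfold Q. rewrite Rmult_plus_distr_r.
      apply Rplus_le_compat; apply Rmult_le_compat; try apply Rabs_pos; try lra.
      now apply Hcot. }
    rewrite <- Cmod_base in Aux by lra. rewrite <- Cmod_pow in Aux.
    split; apply Aux; apply re_le_Cmod || apply im_le_Cmod. }
  assert (Cont : forall x n, lo < x < hi ->
     continuity_pt (fun t => cos t / sin t) x /\
     continuity_pt (fun t => Re (base t ^ S n)%C) x /\
     continuity_pt (fun t => Im (base t ^ S n)%C) x).
  { intros x n Hx. destruct (Hpow x n Hx) as [Hs _].
    destruct (is_derive_base_pow (S n) x) as [D1 D2]; [lra|].
    split; [|split]; apply derivable_continuous_pt, ex_derive_Reals_0.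
    - auto_derive. lra.
    - eexists; exact D1.
    - eexists; exact D2. }
  destruct (two_sin_bound z Hz) as [Hz0 Hz1].
  destruct (ex_base_series (fun n => INR n * c n) K HK z) as [E1 E2]; [lra|].
  split.
  - evar_last.
    + apply (is_derive_series_dominated (fun m t => c (S m) * Re (base t ^ S m)%C)
        (fun m t => INR (S m) * c (S m) *
           (cos t / sin t * Re (base t ^ S m)%C + 1 * Im (base t ^ S m)%C)) M lo hi).
      * intros n x Hx. destruct (Hpow x n Hx) as [Hs _].
        destruct (is_derive_base_pow (S n) x) as [D1 D2]; [lra|].
        evar_last; [apply (is_derive_scal _ x (c (S n)) _ D1)|].
        unfold scal, mult; cbn -[INR Cpow]. unfold mult; cbn -[INR Cpow]. ring.
      * intros n x Hx. destruct (Cont x n Hx) as [C0 [C1 C2]].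
        apply (continuity_pt_scal (fun t => cos t / sin t * Re (base t ^ S n)%C
                                          + 1 * Im (base t ^ S n)%C)).
        apply (continuity_pt_plus (fun t => cos t / sin t * Re (base t ^ S n)%C)
                                  (fun t => 1 * Im (base t ^ S n)%C)).
        -- now apply (continuity_pt_mult (fun t => cos t / sin t)).
        -- now apply (continuity_pt_scal (fun t => Im (base t ^ S n)%C)).
      * intros n x Hx. now apply Bf.
      * intros n x Hx. apply Bg; [exact Hx | rewrite Rabs_R1; lra].
      * exact ExM.
      * exact Hin.
    + unfold re_base_series, im_base_series.
      rewrite <- Series_scal_l, <- Series_plus.
      * apply Series_ext. intro n. ring.
      * apply (@ex_series_scal R_AbsRing R_NormedModule), E1.
      * exact E2.
  - evar_last.
    + apply (is_derive_series_dominated (fun m t => c (S m) * Im (base t ^ S m)%C)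
        (fun m t => INR (S m) * c (S m) *
           (cos t / sin t * Im (base t ^ S m)%C + (-1) * Re (base t ^ S m)%C)) M lo hi).
      * intros n x Hx. destruct (Hpow x n Hx) as [Hs _].
        destruct (is_derive_base_pow (S n) x) as [D1 D2]; [lra|].
        evar_last; [apply (is_derive_scal _ x (c (S n)) _ D2)|].
        unfold scal, mult; cbn -[INR Cpow]. unfold mult; cbn -[INR Cpow]. ring.
      * intros n x Hx. destruct (Cont x n Hx) as [C0 [C1 C2]].
        apply (continuity_pt_scal (fun t => cos t / sin t * Im (base t ^ S n)%C
                                          + (-1) * Re (base t ^ S n)%C)).
        apply (continuity_pt_plus (fun t => cos t / sin t * Im (base t ^ S n)%C)
                                  (fun t => (-1) * Re (base t ^ S n)%C)).
        -- now apply (continuity_pt_mult (fun t => cos t / sin t)).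
        -- now apply (continuity_pt_scal (fun t => Re (base t ^ S n)%C)).
      * intros n x Hx. now apply Bf.
      * intros n x Hx. apply Bg; [exact Hx | rewrite Rabs_left; lra].
      * exact ExM.
      * exact Hin.
    + unfold re_base_series, im_base_series.
      rewrite <- Series_scal_l, <- Series_minus.
      * apply Series_ext. intro n. ring.
      * apply (@ex_series_scal R_AbsRing R_NormedModule), E2.
      * exact E1.
Qed.

Lemma is_series_C (f : nat -> C) (lr li : R) :
  is_series (fun n => Re (f n)) lr -> is_series (fun n => Im (f n)) li ->
  is_series f (lr, li).
Proof.
  intros Hr Hi. unfold is_series.
  apply (filterlim_ext (fun n => (sum_n (fun k => Re (f k)) n, sum_n (fun k => Im (f k)) n))).
  { intro n. induction n as [|n IH].
    - rewrite !sum_O. now destruct (f 0%nat).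
    - rewrite !sum_Sn, <- IH. now destruct (f (S n)). }
  apply (@filterlim_filter_le_2 _ _ _ (filter_prod (locally lr) (locally li))).
  - intros P [eps HP].
    exists (ball lr eps) (ball li eps); [apply locally_ball | apply locally_ball|].
    intros x y Hx Hy. apply HP. now split.
  - now apply filterlim_pair.
Qed.

(** The value is [b / (1 - b) = exp (2 i z) - 1] for [b = base z].  It is obtained
    from the relation [G = b + b G] for the sum [G], whose real and imaginary
    parts form a linear system of determinant [|1 - b| ^ 2 = 1]. *)
Lemma base_series_geom (z : R) : 0 < z < PI / 6 ->
  re_base_series (fun _ => 1) z = - 2 * sin z ^ 2 /\
  im_base_series (fun _ => 1) z = 2 * sin z * cos z.
Proof.
  intro Hz. destruct (two_sin_bound z Hz) as [Hs Hs1].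
  destruct (ex_base_series (fun _ => 1) 1 ltac:(intro; cbv beta; rewrite Rabs_R1; lra) z ltac:(lra)) as [Er Ei].
  assert (Er' : ex_series (fun m => Re (base z ^ S m)%C)).
  { apply (ex_series_ext _ _ (fun m => Rmult_1_l _) Er). }
  assert (Ei' : ex_series (fun m => Im (base z ^ S m)%C)).
  { apply (ex_series_ext _ _ (fun m => Rmult_1_l _) Ei). }
  assert (HR := Series_incr_1 _ Er'). assert (HI := Series_incr_1 _ Ei').
  cbv beta in HR, HI.
  rewrite (Series_ext (fun k => Re (base z ^ S (S k))%C)
    (fun k => 2 * sin z ^ 2 * Re (base z ^ S k)%C - 2 * sin z * cos z * Im (base z ^ S k)%C)) in HR
    by (intro; rewrite Cpow_S, base_eq; reflexivity).
  rewrite (Series_ext (fun k => Im (base z ^ S (S k))%C)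
    (fun k => 2 * sin z ^ 2 * Im (base z ^ S k)%C + 2 * sin z * cos z * Re (base z ^ S k)%C)) in HI
    by (intro; rewrite Cpow_S, base_eq; reflexivity).
  rewrite Series_minus, !Series_scal_l in HR by
    (apply (@ex_series_scal R_AbsRing R_NormedModule); assumption).
  rewrite Series_plus, !Series_scal_l in HI by
    (apply (@ex_series_scal R_AbsRing R_NormedModule); assumption).
  replace (Re (base z ^ 1)%C) with (2 * sin z ^ 2) in HR
    by (rewrite base_eq; unfold Cmult, Re; simpl; ring).
  replace (Im (base z ^ 1)%C) with (2 * sin z * cos z) in HI
    by (rewrite base_eq; unfold Cmult, Im; simpl; ring).
  unfold re_base_series, im_base_series.
  rewrite (Series_ext (fun m => 1 * Re _) _ (fun m => Rmult_1_l _)).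
  rewrite (Series_ext (fun m => 1 * Im _) _ (fun m => Rmult_1_l _)).
  revert HR HI.
  generalize (Series (fun m => Re (base z ^ S m)%C)) (Series (fun m => Im (base z ^ S m)%C)).
  intros Sr Si HR HI.
  assert (E : cos z * cos z = 1 - sin z * sin z).
  { generalize (sin2_cos2 z). unfold Rsqr. lra. }
  set (s := sin z) in *. set (k := cos z) in *.
  assert (HR' : (1 - 2 * s ^ 2) * Sr + 2 * s * k * Si = 2 * s ^ 2) by lra.
  assert (HI' : (1 - 2 * s ^ 2) * Si - 2 * s * k * Sr = 2 * s * k) by lra.
  assert (Det : (1 - 2 * s ^ 2) ^ 2 + (2 * s * k) ^ 2 = 1).
  { replace ((2 * s * k) ^ 2) with (4 * s ^ 2 * (k * k)) by ring. rewrite E. ring. }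
  split.
  - replace Sr with (((1 - 2 * s ^ 2) ^ 2 + (2 * s * k) ^ 2) * Sr) by (rewrite Det; ring).
    replace (_ * Sr) with ((1 - 2 * s ^ 2) * ((1 - 2 * s ^ 2) * Sr + 2 * s * k * Si)
      - 2 * s * k * ((1 - 2 * s ^ 2) * Si - 2 * s * k * Sr)) by ring.
    rewrite HR', HI'. replace (2 * s * k * (2 * s * k)) with (4 * s ^ 2 * (k * k)) by ring.
    rewrite E. ring.
  - replace Si with (((1 - 2 * s ^ 2) ^ 2 + (2 * s * k) ^ 2) * Si) by (rewrite Det; ring).
    replace (_ * Si) with ((1 - 2 * s ^ 2) * ((1 - 2 * s ^ 2) * Si - 2 * s * k * Sr)
      + 2 * s * k * ((1 - 2 * s ^ 2) * Sr + 2 * s * k * Si)) by ring.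
    rewrite HR', HI'. ring.
Qed.

Definition cterm_coef (a : R) (n : nat) : R := / (INR n ^ 2 - a ^ 2).
Definition ncterm_coef (a : R) (n : nat) : R := INR n / (INR n ^ 2 - a ^ 2).

Lemma euler_cterm_coef_bound (a : R) (n : nat) : -1 < a < 1 ->
  Rabs (INR (S n) * cterm_coef a (S n)) <= / (1 - a ^ 2).
Proof. apply lin_weight_bound. Qed.

Lemma euler_ncterm_coef_bound (a : R) (n : nat) : -1 < a < 1 ->
  Rabs (INR (S n) * ncterm_coef a (S n)) <= / (1 - a ^ 2).
Proof.
  intro Ha. unfold ncterm_coef.
  replace (_ * _) with (INR (S n) ^ 2 / (INR (S n) ^ 2 - a ^ 2)) by (unfold Rdiv; ring).
  now apply sq_weight_bound.
Qed.

Lemma cterm_coef_bound (a : R) (n : nat) : -1 < a < 1 -> Rabs (cterm_coef a (S n)) <= / (1 - a ^ 2).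
Proof.
  intro Ha. eapply Rle_trans; [|apply (euler_cterm_coef_bound a n Ha)].
  rewrite Rabs_mult, <- (Rmult_1_l (Rabs (cterm_coef a (S n)))) at 1.
  apply Rmult_le_compat_r; [apply Rabs_pos|].
  assert (1 <= INR (S n)) by (apply (le_INR 1); lia). rewrite Rabs_right; lra.
Qed.

Lemma ncterm_coef_bound (a : R) (n : nat) : -1 < a < 1 -> Rabs (ncterm_coef a (S n)) <= / (1 - a ^ 2).
Proof. apply lin_weight_bound. Qed.

(** From [n ^ 2 / (n ^ 2 - a ^ 2) = 1 + a ^ 2 / (n ^ 2 - a ^ 2)]. *)
Lemma base_series_euler_ncterm_coef (a z : R) : -1 < a < 1 -> 0 < z < PI / 6 ->
  re_base_series (fun n => INR n * ncterm_coef a n) z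
  = - 2 * sin z ^ 2 + a ^ 2 * re_base_series (cterm_coef a) z /\
  im_base_series (fun n => INR n * ncterm_coef a n) z
  = 2 * sin z * cos z + a ^ 2 * im_base_series (cterm_coef a) z.
Proof.
  intros Ha Hz. destruct (two_sin_bound z Hz) as [Hs Hs1].
  destruct (base_series_geom z Hz) as [Gr Gi]. rewrite <- Gr, <- Gi.
  destruct (ex_base_series (fun _ => 1) 1 ltac:(intro; cbv beta; rewrite Rabs_R1; lra) z ltac:(lra)) as [Er Ei].
  destruct (ex_base_series (cterm_coef a) _ (fun n => cterm_coef_bound a n Ha) z ltac:(lra)) as [Fr Fi].
  assert (Hc : forall n, INR (S n) * ncterm_coef a (S n) = 1 + a ^ 2 * cterm_coef a (S n)).
  { intro n. unfold cterm_coef, ncterm_coef. field. now apply sq_minus_sq_neq_0. }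
  unfold re_base_series, im_base_series.
  rewrite <- !Series_scal_l, <- !Series_plus by
    (assumption || (apply (@ex_series_scal R_AbsRing R_NormedModule); assumption)).
  split; apply Series_ext; intro n; rewrite Hc; ring.
Qed.

(** Equations left by [evar_last] live in the carrier of a normed module, where
    [ring] and [field] do not recognize the real numbers. *)
Ltac eq_in_R := match goal with |- @eq _ ?x ?y => change (@eq R x y) end.

(** In complex form, [S0' = (cot z - i) S1] and
    [S1' = 2 i + a ^ 2 (cot z - i) S0]. *)
Lemma is_derive_base_series_coefs (a z : R) : -1 < a < 1 -> 0 < z < PI / 6 ->
  is_derive (re_base_series (cterm_coef a)) z
    (cos z / sin z * re_base_series (ncterm_coef a) z + im_base_series (ncterm_coef a) z) /\
  is_derive (im_base_series (cterm_coef a)) z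
    (cos z / sin z * im_base_series (ncterm_coef a) z - re_base_series (ncterm_coef a) z) /\
  is_derive (re_base_series (ncterm_coef a)) z
    (a ^ 2 * (cos z / sin z * re_base_series (cterm_coef a) z + im_base_series (cterm_coef a) z)) /\
  is_derive (im_base_series (ncterm_coef a)) z
    (2 + a ^ 2 * (cos z / sin z * im_base_series (cterm_coef a) z - re_base_series (cterm_coef a) z)).
Proof.
  intros Ha Hz. destruct (two_sin_bound z Hz) as [Hs Hs1].
  destruct (is_derive_base_series (cterm_coef a) _ z (fun n => euler_cterm_coef_bound a n Ha) Hz) as [D1 D2].
  destruct (is_derive_base_series (ncterm_coef a) _ z (fun n => euler_ncterm_coef_bound a n Ha) Hz) as [D3 D4].
  destruct (base_series_euler_ncterm_coef a z Ha Hz) as [E1 E2].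
  rewrite E1, E2 in D3, D4.
  split; [exact D1|split; [exact D2|split]].
  - evar_last; [exact D3|]. eq_in_R. field. lra.
  - evar_last; [exact D4|]. eq_in_R.
    generalize (sin2_cos2 z). unfold Rsqr. intro P.
    transitivity (2 * (sin z * sin z + cos z * cos z) + a ^ 2 *
      (cos z / sin z * im_base_series (cterm_coef a) z - re_base_series (cterm_coef a) z)).
    + field. lra.
    + rewrite P. ring.
Qed.

(** * Comparison of the two sides *)

Lemma is_derive_trig_comb (a p q z f' g' : R) (f g : R -> R) :
  is_derive f z f' -> is_derive g z g' ->
  is_derive (fun t => (p * cos (a * t)) * f t + (q * sin (a * t)) * g t) z
    (p * (cos (a * z) * f' - a * sin (a * z) * f z)
     + q * (sin (a * z) * g' + a * cos (a * z) * g z)).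
Proof.
  intros Df Dg. evar_last.
  - apply (is_derive_plus (fun t => p * cos (a * t) * f t) (fun t => q * sin (a * t) * g t)).
    + apply (is_derive_mult (fun t => p * cos (a * t)) f); [|exact Df|exact Rmult_comm].
      auto_derive; [exact I|reflexivity].
    + apply (is_derive_mult (fun t => q * sin (a * t)) g); [|exact Dg|exact Rmult_comm].
      auto_derive; [exact I|reflexivity].
  - unfold plus, mult; simpl. ring.
Qed.

Lemma O_sin_trig_comb (a p q : R) (f g : R -> R) : O_sin f -> O_sin g ->
  O_sin (fun t => (p * cos (a * t)) * f t + (q * sin (a * t)) * g t).
Proof.
  apply (O_sin_comb _ _ _ _ (Rabs p) (Rabs q)); intro x; rewrite Rabs_mult;
    rewrite <- Rmult_1_r; (apply Rmult_le_compat_l; [apply Rabs_pos|]); apply Rabs_le.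
  - apply COS_bound.
  - apply SIN_bound.
Qed.

Section Sides.
Variable a : R.
Hypothesis Ha : -1 < a < 1.

(** The factors [1] and [-1] give the four functions the common shape of
    [is_derive_trig_comb]. *)
Definition rhs_even1 (t : R) : R :=
  -1 * cos (a * t) * re_base_series (ncterm_coef a) t + a * sin (a * t) * im_base_series (cterm_coef a) t.
Definition rhs_even2 (t : R) : R :=
  - a * cos (a * t) * re_base_series (cterm_coef a) t + 1 * sin (a * t) * im_base_series (ncterm_coef a) t.
Definition rhs_odd1 (t : R) : R :=
  1 * cos (a * t) * im_base_series (ncterm_coef a) t + a * sin (a * t) * re_base_series (cterm_coef a) t.
Definition rhs_odd2 (t : R) : R :=
  a * cos (a * t) * im_base_series (cterm_coef a) t + 1 * sin (a * t) * re_base_series (ncterm_coef a) t.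

(** The rotation by [a z] is chosen so that the terms of [S0'] and [S1'] without
    a cotangent cancel, except for the constant [2 i]. *)
Lemma is_derive_rhs (z : R) : 0 < z < PI / 6 ->
  is_derive rhs_even1 z (a * (cos z / sin z) * rhs_even2 z) /\
  is_derive rhs_even2 z (2 * sin (a * z) + a * (cos z / sin z) * rhs_even1 z) /\
  is_derive rhs_odd1 z (2 * cos (a * z) + a * (cos z / sin z) * rhs_odd2 z) /\
  is_derive rhs_odd2 z (a * (cos z / sin z) * rhs_odd1 z).
Proof.
  intro Hz. destruct (is_derive_base_series_coefs a z Ha Hz) as [D1 [D2 [D3 D4]]].
  unfold rhs_even1, rhs_even2, rhs_odd1, rhs_odd2.
  split; [|split; [|split]]; (evar_last; [apply is_derive_trig_comb; eassumption | eq_in_R; ring]).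
Qed.

Lemma O_sin_rhs : O_sin rhs_even1 /\ O_sin rhs_even2 /\ O_sin rhs_odd1 /\ O_sin rhs_odd2.
Proof.
  destruct (base_series_small (cterm_coef a) _ (fun n => cterm_coef_bound a n Ha)) as [B1 B2].
  destruct (base_series_small (ncterm_coef a) _ (fun n => ncterm_coef_bound a n Ha)) as [B3 B4].
  split; [|split; [|split]]; now apply O_sin_trig_comb.
Qed.

Definition weighted_sum (y0 y1 t : R) : R := PSeries (weighted_coef a y0 y1) (sin t).
Definition euler_weighted_sum (y0 y1 t : R) : R := PSeries (fun n => INR n * weighted_coef a y0 y1 n) (sin t).

Lemma O_sin_weighted_sums (y0 y1 : R) : Rabs y0 <= 1 -> Rabs y1 <= 1 ->
  O_sin (weighted_sum y0 y1) /\ O_sin (euler_weighted_sum y0 y1).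
Proof.
  intros H0 H1. split.
  - apply (PSeries_sin_small _ (/ (1 - a ^ 2))).
    + unfold weighted_coef. simpl. unfold Rdiv. ring.
    + intro n. now apply weighted_coef_bound.
  - apply (PSeries_sin_small _ (/ (1 - a ^ 2))).
    + simpl. ring.
    + intro n. now apply euler_weighted_coef_bound.
Qed.

(** When [a <> 0] this is one application of [cot_system_zero]; to include
    [a = 0], the first relation is deduced from the second by integration, its
    two sides having proportional derivatives. *)
Lemma even_sides (z : R) : 0 < z < PI / 6 ->
  - 2 * weighted_sum 1 0 z = rhs_even1 z /\ - 2 * euler_weighted_sum 1 0 z = a * rhs_even2 z.
Proof.
  intro Hz. assert (HPI := PI_RGT_0).
  assert (H1 : Rabs 1 <= 1) by (rewrite Rabs_R1; lra).
  assert (H0 : Rabs 0 <= 1) by (rewrite Rabs_R0; lra).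
  destruct O_sin_rhs as [O1 [O2 _]]. destruct (O_sin_weighted_sums 1 0 H1 H0) as [OM1 OM2].
  assert (V : forall t, 0 < t < PI / 6 -> 1 * euler_weighted_sum 1 0 t + a / 2 * rhs_even2 t = 0).
  { intros t Ht.
    apply (cot_system_zero a (PI / 6) (fun t => a * weighted_sum 1 0 t + a / 2 * rhs_even1 t)
             (fun t => 1 * euler_weighted_sum 1 0 t + a / 2 * rhs_even2 t)); try lra; try (now apply O_sin_lin).
    - intros x Hx. destruct (is_derive_rhs x Hx) as [D1 _].
      evar_last.
      + apply (is_derive_plus (fun t => a * weighted_sum 1 0 t) (fun t => a / 2 * rhs_even1 t)).
        * apply (is_derive_scal (weighted_sum 1 0)), is_derive_weighted; try assumption; lra.
        * apply (is_derive_scal rhs_even1), D1.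
      + unfold plus, scal; simpl. unfold mult; simpl. unfold euler_weighted_sum. field.
        apply Rgt_not_eq, sin_gt_0; lra.
    - intros x Hx. destruct (is_derive_rhs x Hx) as [_ [D2 _]].
      evar_last.
      + apply (is_derive_plus (fun t => 1 * euler_weighted_sum 1 0 t) (fun t => a / 2 * rhs_even2 t)).
        * apply (is_derive_scal (euler_weighted_sum 1 0)), is_derive_euler_weighted; try assumption; lra.
        * apply (is_derive_scal rhs_even2), D2.
      + unfold plus, scal; simpl. unfold mult; simpl. unfold weighted_sum. field.
        apply Rgt_not_eq, sin_gt_0; lra. }
  assert (U : 1 * weighted_sum 1 0 z + / 2 * rhs_even1 z = 0).
  { apply (cot_ode_zero 0 (PI / 6) (fun t => 1 * weighted_sum 1 0 t + / 2 * rhs_even1 t)); try lra.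
    - intros x Hx. destruct (is_derive_rhs x Hx) as [D1 _].
      evar_last.
      + apply (is_derive_plus (fun t => 1 * weighted_sum 1 0 t) (fun t => / 2 * rhs_even1 t)).
        * apply (is_derive_scal (weighted_sum 1 0)), is_derive_weighted; try assumption; lra.
        * apply (is_derive_scal rhs_even1), D1.
      + unfold plus, scal; simpl. unfold mult; simpl.
        specialize (V x Hx). unfold euler_weighted_sum in V.
        transitivity (cos x / sin x *
          (1 * PSeries (fun n => INR n * weighted_coef a 1 0 n) (sin x) + a / 2 * rhs_even2 x)).
        * field. apply Rgt_not_eq, sin_gt_0; lra.
        * rewrite V. ring.
    - now apply O_sin_lin. }
  specialize (V z Hz). lra.
Qed.

Lemma odd_sides (z : R) : 0 < z < PI / 6 ->
  2 * euler_weighted_sum 0 1 z = rhs_odd1 z /\ 2 * a * weighted_sum 0 1 z = rhs_odd2 z.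
Proof.
  intro Hz. assert (HPI := PI_RGT_0).
  assert (H1 : Rabs 1 <= 1) by (rewrite Rabs_R1; lra).
  assert (H0 : Rabs 0 <= 1) by (rewrite Rabs_R0; lra).
  destruct O_sin_rhs as [_ [_ [O3 O4]]]. destruct (O_sin_weighted_sums 0 1 H0 H1) as [OM1 OM2].
  destruct (cot_system_zero a (PI / 6) (fun t => a * weighted_sum 0 1 t + - / 2 * rhs_odd2 t)
             (fun t => 1 * euler_weighted_sum 0 1 t + - / 2 * rhs_odd1 t)) with (x := z) as [U V];
    try lra; try (now apply O_sin_lin).
  - intros x Hx. destruct (is_derive_rhs x Hx) as [_ [_ [_ D4]]].
    evar_last.
    + apply (is_derive_plus (fun t => a * weighted_sum 0 1 t) (fun t => - / 2 * rhs_odd2 t)).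
      * apply (is_derive_scal (weighted_sum 0 1)), is_derive_weighted; try assumption; lra.
      * apply (is_derive_scal rhs_odd2), D4.
    + unfold plus, scal; simpl. unfold mult; simpl. unfold euler_weighted_sum. field.
      apply Rgt_not_eq, sin_gt_0; lra.
  - intros x Hx. destruct (is_derive_rhs x Hx) as [_ [_ [D3 _]]].
    evar_last.
    + apply (is_derive_plus (fun t => 1 * euler_weighted_sum 0 1 t) (fun t => - / 2 * rhs_odd1 t)).
      * apply (is_derive_scal (euler_weighted_sum 0 1)), is_derive_euler_weighted; try assumption; lra.
      * apply (is_derive_scal rhs_odd1), D3.
    + unfold plus, scal; simpl. unfold mult; simpl. unfold weighted_sum. field.
      apply Rgt_not_eq, sin_gt_0; lra.
Qed.

Lemma Series_even_terms (z : R) : 0 < z < PI / 6 ->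
  a ^ 2 * Series (fun m => even_term1 a z (S m)) = - 2 * weighted_sum 1 0 z /\
  a ^ 2 * Series (fun m => even_term2 a z (S m)) = - euler_weighted_sum 1 0 z.
Proof.
  intro Hz. assert (HPI := PI_RGT_0).
  assert (H1 : Rabs 1 <= 1) by (rewrite Rabs_R1; lra).
  assert (H0 : Rabs 0 <= 1) by (rewrite Rabs_R0; lra).
  assert (Hs : Rabs (sin z) < 1) by (apply Rabs_sin_lt_1; lra).
  assert (W : forall n, weighted_coef a 1 0 (2 * n + 1) = 0).
  { intro n. unfold weighted_coef. rewrite sin_coef_odd_zero. unfold Rdiv. ring. }
  unfold weighted_sum, euler_weighted_sum. split.
  - rewrite (PSeries_even _ (/ (1 - a ^ 2))); try assumption.
    + rewrite <- !Series_scal_l. apply Series_ext. intro m. now apply even_term1_weighted.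
    + intro n. now apply weighted_coef_bound.
    + unfold weighted_coef. simpl. unfold Rdiv. ring.
  - rewrite (PSeries_even _ (/ (1 - a ^ 2))); try assumption.
    + rewrite <- Series_opp, <- !Series_scal_l. apply Series_ext. intro m.
      now apply even_term2_euler_weighted.
    + intro n. now apply euler_weighted_coef_bound.
    + simpl. ring.
    + intro n. rewrite W. ring.
Qed.

Lemma is_series_odd_terms (z : R) : 0 < z < PI / 6 ->
  is_series (odd_term1 a z) (euler_weighted_sum 0 1 z) /\ is_series (odd_term2 a z) (weighted_sum 0 1 z).
Proof.
  intro Hz. assert (HPI := PI_RGT_0).
  assert (H1 : Rabs 1 <= 1) by (rewrite Rabs_R1; lra).
  assert (H0 : Rabs 0 <= 1) by (rewrite Rabs_R0; lra).
  assert (Hs : Rabs (sin z) < 1) by (apply Rabs_sin_lt_1; lra).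
  assert (W : forall n, weighted_coef a 0 1 (2 * n) = 0).
  { intro n. unfold weighted_coef. rewrite sin_coef_even_zero. unfold Rdiv. ring. }
  unfold weighted_sum, euler_weighted_sum. split.
  - eapply is_series_ext; [intro n; symmetry; apply odd_term1_euler_weighted|].
    apply (is_series_PSeries_odd (fun n => INR n * weighted_coef a 0 1 n) (/ (1 - a ^ 2)));
      try assumption.
    + intro n. now apply euler_weighted_coef_bound.
    + intro n. rewrite W. ring.
  - eapply is_series_ext; [intro n; symmetry; apply odd_term2_weighted|].
    apply (is_series_PSeries_odd _ (/ (1 - a ^ 2))); try assumption.
    intro n. now apply weighted_coef_bound.
Qed.

Lemma is_series_cterms (z : R) : 0 < z < PI / 6 ->
  is_series (fun m => cterm a z (S m)) (re_base_series (cterm_coef a) z, im_base_series (cterm_coef a) z) /\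
  is_series (fun m => ncterm a z (S m)) (re_base_series (ncterm_coef a) z, im_base_series (ncterm_coef a) z).
Proof.
  intro Hz. destruct (two_sin_bound z Hz) as [Hs Hs1].
  destruct (ex_base_series (cterm_coef a) _ (fun n => cterm_coef_bound a n Ha) z ltac:(lra)) as [Fr Fi].
  destruct (ex_base_series (ncterm_coef a) _ (fun n => ncterm_coef_bound a n Ha) z ltac:(lra)) as [Gr Gi].
  split; apply is_series_C;
    (eapply is_series_ext; [|apply Series_correct; eassumption]); intro n; cbv beta;
    assert (Hq := sq_minus_sq_neq_0 a Ha n);
    unfold cterm, ncterm, cterm_coef, ncterm_coef, Cdiv, Cinv, Cmult, RtoC, Re, Im; cbn [fst snd];
    eq_in_R; field; exact Hq.
Qed.
End Sides.

Theorem lemma4p4 (a z : R) (ha : -1 < a < 1) (hz : 0 < z < PI / 6) :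
  exists S0 S1 : C,
    is_series (fun m : nat => cterm a z (S m)) S0 /\
    is_series (fun m : nat => ncterm a z (S m)) S1 /\
    (ex_series (fun m : nat => even_term1 a z (S m)) /\
     a ^ 2 * Series (fun m : nat => even_term1 a z (S m))
     = - cos (a * z) * Re S1 + a * sin (a * z) * Im S0) /\
    (ex_series (fun m : nat => even_term2 a z (S m)) /\
     2 * a * Series (fun m : nat => even_term2 a z (S m))
     = - a * cos (a * z) * Re S0 + sin (a * z) * Im S1) /\
    (ex_series (fun n : nat => odd_term1 a z n) /\
     2 * Series (fun n : nat => odd_term1 a z n)
     = cos (a * z) * Im S1 + a * sin (a * z) * Re S0) /\
    (ex_series (fun n : nat => odd_term2 a z n) /\
     2 * a * Series (fun n : nat => odd_term2 a z n)
     = a * cos (a * z) * Im S0 + sin (a * z) * Re S1).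
Proof.
  destruct (two_sin_bound z hz) as [Hs Hs1].
  destruct (is_series_cterms a ha z hz) as [HC0 HC1].
  destruct (ex_series_even_terms a z ha ltac:(lra)) as [Ex1 Ex2].
  destruct (Series_even_terms a ha z hz) as [E1 E2].
  destruct (is_series_odd_terms a ha z hz) as [O1 O2].
  destruct (even_sides a ha z hz) as [L1 L2].
  destruct (odd_sides a ha z hz) as [L3 L4].
  eexists; eexists.
  split; [exact HC0|]. split; [exact HC1|].
  split; [|split; [|split]]; split.
  - exact Ex1.
  - rewrite E1, L1. unfold rhs_even1, Re, Im; simpl. ring.
  - exact Ex2.
  - assert (H : a * (2 * a * Series (fun m : nat => even_term2 a z (S m))) = a * rhs_even2 a z) by lra.
    unfold rhs_even2 in H. unfold Re, Im; cbn [fst snd].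
    destruct (Req_dec a 0) as [Ha0|Ha0].
    + rewrite Ha0, (Rmult_0_l z), sin_0. ring.
    + apply (Rmult_eq_reg_l a); [|exact Ha0]. rewrite H. ring.
  - eexists; exact O1.
  - rewrite (is_series_unique (fun n => odd_term1 a z n) _ O1), L3. unfold rhs_odd1, Re, Im; simpl. ring.
  - eexists; exact O2.
  - rewrite (is_series_unique (fun n => odd_term2 a z n) _ O2), L4. unfold rhs_odd2, Re, Im; simpl. ring.
Qed.
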